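(* Assume the Hardy-Littlewood Conjecture. Let $D=\pm 2 p_1\cdots p_r(q_1\cdots q_s)^2(l_1\cdots l_t)^3$ (so $2\parallel D$), let $\beta$ be a nonzero even integer, let $D=d\bar d$ and the associated quantities be as in the context, and assume that $\bar d$ has some odd prime factor. Put $$A=\frac{(-1)^{r''+t''}}{\tau(\bar d_p\bar d_l)},\qquad B=\frac{2(-1)^{r_1''+r_5''+t_1''+t_5''+s''+\frac{d-1}{2}}}{\tau(\bar d_p\bar d_q\bar d_l)}.$$ (1) If $2\parallel\beta$, with the sign of $\beta$ chosen so that $\beta\equiv2\pmod 8$, then: for $D>0$, $\mathrm{dens}_D(2\beta)=\frac14(1+A+B)$ and $\mathrm{dens}_D(-2\beta)=\frac14(1+A-B)$; for $D<0$, $\mathrm{dens}_D(2\beta)=\frac14(1+A-B)$ and $\mathrm{dens}_D(-2\beta)=\frac14(1+A+B)$. (2) If $4\mid\beta$, then $\mathrm{dens}_D(2\beta)=\mathrm{dens}_D(-2\beta)=\frac14(1-A)$.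
   Context: In $D=\pm 2 p_1\cdots p_r(q_1\cdots q_s)^2(l_1\cdots l_t)^3$, $r,s,t\ge0$ and the $p_i,q_i,l_i$ are pairwise distinct odd primes. Write $D=d\bar d$ with $\gcd(d,\bar d)=1$, $d>0$ odd, every prime factor of $d$ dividing $\beta$, and no odd prime factor of $\bar d$ dividing $\beta$. Write $\bar d=\pm2\,\bar d_p\bar d_q^2\bar d_l^3$ with $\bar d_p,\bar d_q,\bar d_l$ positive, odd, squarefree and pairwise coprime. $r'',s'',t''$ are the numbers of prime factors of $\bar d_p,\bar d_q,\bar d_l$ respectively; $r_i'',t_i''$ are the numbers of prime factors congruent to $i$ mod $8$ of $\bar d_p,\bar d_l$ respectively. On odd squarefree positive integers, $\tau(n)=\prod_{l\mid n}\tau(l)$ with $\tau(l)=l$ if $l\equiv3\pmod4$, $\tau(l)=l-2$ if $l\equiv1\pmod4$, and $\tau(1)=1$. $2^k\parallel n$ means $2^k\mid n$ and $2^{k+1}\nmid n$. For a nonzero integer $D$, $E_D$ is the elliptic curve $y^2=x^3+Dx$, and for a prime $p\nmid 2D$, $a_p(E_D)=1+p-\#\tilde E_D(\mathbb{F}_p)$. For a nonzero integer $m$ put $Q(m,N)=\{p \text{ prime}: p=m^2+x^2\le N \text{ for some } x\in\mathbb{Z}\}$ and $$\mathrm{dens}_D(2m)=\lim_{N\to\infty}\frac{\#\{p\in Q(m,N): p\nmid 2D,\ a_p(E_D)=2m\}}{\#Q(m,N)}$$ (denoted $a_p(2m)$ in the paper); the claim includes that the limits exist. Hardy-Littlewood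 Conjecture: for all integers $a,b,c$ with $a>0$, $\gcd(a,b,c)=1$, $a+b$ and $c$ not both even, and $\Delta=b^2-4ac$ not a perfect square, the number $P(n)$ of primes less than $n$ of the form $ax^2+bx+c$ (with $x$ a nonnegative integer) satisfies $P(n)\sim\delta(a,b,c)\frac{\sqrt{n}}{\log n}$ as $n\to\infty$, where $$\delta(a,b,c)=\frac{\gcd(2,a+b)}{\sqrt{a}}\prod_{p\mid a,\ p\mid b,\ p>2}\frac{p}{p-1}\ \prod_{p\nmid a,\ p>2}\left(1-\frac{\left(\frac{\Delta}{p}\right)}{p-1}\right),$$ the products being over primes (the second taken in increasing order of $p$) and $\left(\frac{\cdot}{p}\right)$ being the Legendre symbol. *)

(* Defs.v *)
From HB Require Import structures.
From mathcomp Require Import all_boot all_order all_algebra.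
From mathcomp Require Import all_classical all_reals all_analysis.

Set Implicit Arguments.
Unset Strict Implicit.
Unset Printing Implicit Defensive.

Import Order.TTheory GRing.Theory Num.Theory.
Import numFieldNormedType.Exports.

Local Open Scope classical_set_scope.
Local Open Scope ring_scope.

(* 2^k || n *)
Definition exact_pow2 (k : nat) (n : int) : bool :=
  ((2 ^ k)%N%:Z %| n)%Z && ~~ ((2 ^ k.+1)%N%:Z %| n)%Z.

Definition squarefree (n : nat) : Prop :=
  forall k : nat, (k ^ 2 %| n)%N -> k = 1%N.

(* Only meaningful for n odd and squarefree, so that every prime l that occurs
   satisfies l = 3 or l = 1 modulo 4. *)
Definition tau (n : nat) : nat :=
  (\prod_(l <- primes n) (if l %% 4 == 3 then l else l - 2))%N.

Definition nprimes (n : nat) : nat := size (primes n).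

Definition nprimes_mod8 (i n : nat) : nat :=
  count (fun l => l %% 8 == i)%N (primes n).

(* Number of projective points of y^2 = x^3 + D x over F_p: the affine solutions
   and the point at infinity. Meaningful for p prime, p not dividing 2D. *)
Definition npoints (D : int) (p : nat) : nat :=
  #|[pred P : 'F_p * 'F_p | P.2 ^+ 2 == P.1 ^+ 3 + D%:~R * P.1]|.+1.

Definition ap (D : int) (p : nat) : int := 1 + p%:Z - (npoints D p)%:Z.

(* Q(m, N), as a duplicate-free list. *)
Definition Qseq (m : int) (N : nat) : seq nat :=
  [seq p <- iota 0 N.+1 |
    prime p && `[< exists x : int, p%:Z = m ^+ 2 + x ^+ 2 >]].

(* The quotient whose limit as N tends to infinity is dens_D(2m). *)
Definition dens_quotient (R : realType) (D m : int) (N : nat) : R :=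
  (count (fun p => ~~ (p%:Z %| 2 * D)%Z && (ap D p == 2 * m)) (Qseq m N))%:R
  / (size (Qseq m N))%:R.

(* "dens_D(2m) exists and equals v" *)
Definition has_dens (R : realType) (D m : int) (v : R) : Prop :=
  dens_quotient R D m @ \oo --> v.

(* Legendre symbol (a / p), for p an odd prime. *)
Definition legendre (a : int) (p : nat) : int :=
  if (p%:Z %| a)%Z then 0
  else if [exists x : 'F_p, x ^+ 2 == a%:~R] then 1 else -1.

Definition discr (a b c : int) : int := b ^+ 2 - 4 * a * c.

(* The conditionally convergent product over the primes p > 2 not dividing a, in
   increasing order of p, is the limit of its partial products over p < n. *)
Definition HL_partial (R : realType) (a b c : int) (n : nat) : R :=
  \prod_(0 <= p < n | [&& prime p, (2 < p)%N & ~~ (p%:Z %| a)%Z])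
    (1 - (legendre (discr a b c) p)%:~R / (p%:R - 1)).

Definition HL_delta (R : realType) (a b c : int) : R :=
  (gcdz 2 (a + b))%:~R / Num.sqrt (a%:~R)
  * \prod_(p <- primes `|a|%N | (p%:Z %| b)%Z && (2 < p)%N)
      (p%:R / (p%:R - 1))
  * limn (HL_partial R a b c).

Definition HL_count (a b c : int) (n : nat) : nat :=
  count (fun p => prime p &&
           `[< exists x : nat, p%:Z = a * x%:Z ^+ 2 + b * x%:Z + c >])
        (iota 0 n).

(* P(n) ~ g(n) is read as P(n) / g(n) --> 1. *)
Definition HardyLittlewood (R : realType) : Prop :=
  forall a b c : int,
    0 < a ->
    gcdz (gcdz a b) c = 1 ->
    ~ ((2 %| a + b)%Z /\ (2 %| c)%Z) ->
    ~ (exists k : int, discr a b c = k ^+ 2) ->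
    cvgn (HL_partial R a b c) /\
    (fun n => (HL_count a b c n)%:R
       / (HL_delta R a b c * (Num.sqrt (n%:R : R) / ln (n%:R : R))))
      @ \oo --> (1 : R).

(* Main.v *)
Require Import Defs.
From mathcomp Require Import all_boot all_order all_algebra all_field.
From mathcomp Require Import ring zify.
From mathcomp Require Import all_classical all_reals all_analysis.
Import Order.TTheory GRing.Theory Num.Theory.
Import numFieldNormedType.Exports.
Local Open Scope ring_scope.

(** Write p = m^2 + x^2 with m = 2 h even and x odd. The quartic character chi
    modulo p for which i corresponds to m / x gives the trace of y^2 = x^3 +
    D x: counting points and substituting t = x^2 leaves Jacobi sums
    ([curve_trace]), and the Jacobi sum of chi and chi^2 is a generator of
    the prime x + m i congruent to 1 modulo 2 + 2 i, hence eps (x + m i)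
    with eps = +-1 fixed by x modulo 4 ([primary_sign]). So the trace is
    twice the real part of eps (x + m i) / chi(-D), and it equals 2 m
    exactly when chi(-D) = eps i ([ap_eq]).

    Since D is rational, chi(-D) is a function of x alone. For an odd prime q,
    the Gauss sum of chi in characteristic q, compared with its image under
    Frobenius, yields chi(q') = u^((q' - 1) / 4) modulo q, where q' = +-q is 1
    modulo 4 and u = (x + m i) / (x - m i) ([qchar_signed_prime]). This is 1
    if q divides m, so that the prime factors of d only contribute signs; the
    values chi(-1) = (-1)^h and chi(2) = i^(x h) ([qexp_two]) complete the
    computation, and the condition on the trace becomes a congruence on x
    modulo M = 4 * (the product of the odd prime factors of dbar)
    ([ap_condition]).

    The polynomials (x0 + M k)^2 + m^2 have the same Hardy-Littlewood constant
    for all x0 such that x0^2 + m^2 is prime to M. The conjecture thus gives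
    the density as a proportion of admissible residues ([HL_density]). For q
    prime to m, u runs over the elements other than 1 of a cyclic group of
    order n = q - 1 or q + 1 when x runs modulo q ([quot_class_count]); there
    are tau(q) = n - 1 of them, and a nontrivial quartic character of u has
    sum -1. By the Chinese remainder theorem the distribution of the total
    exponent is given by products of such local sums ([wcount_fourier]): the
    square of the character averages to A, while the character and its
    conjugate contribute B up to sign if 2 || m, and cancel between the two
    classes of x modulo 4 if 4 divides m. *)

Set Implicit Arguments.
Unset Strict Implicit.
Unset Printing Implicit Defensive.

(** * Congruences modulo 8 and prime factors *)

Lemma odd_eqmod4 a b : a = b %[mod 4] -> odd a = odd b.
Proof. by move/(congr1 odd); rewrite !odd_mod. Qed.

Lemma mod4_double l : (2 * l %% 4 = 2 * odd l)%N.
Proof. by rewrite -modn2 muln_modr. Qed.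

Lemma int_sqr_le1 (k : int) : k != 0 -> k ^+ 2 <= 1 -> (k == 1) || (k == -1).
Proof.
move=> k0 k2; have : `|k| <= 1.
  by rewrite -(@ler_pXn2r _ 2) ?nnegrE // expr1n -normrX ger0_norm ?sqr_ge0.
by clear k2; lia.
Qed.

Lemma two_dvd_sqr_sub (k : int) : (2 %| k ^+ 2 - k)%Z.
Proof.
have [q [kq|kq]] : exists q : int, k = q * 2 \/ k = q * 2 + 1.
  by exists (k %/ 2)%Z; lia.
- by rewrite kq; apply/dvdzP; exists (2 * q ^+ 2 - q); ring.
by rewrite kq; apply/dvdzP; exists (2 * q ^+ 2 + q); ring.
Qed.

(** The character n -> (2 / n) of the odd integers, as a parity. *)
Definition two_char (n : nat) : bool := (n %% 8 == 3)%N || (n %% 8 == 5)%N.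

Lemma two_charM a b : odd a -> odd b -> two_char (a * b) = two_char a (+) two_char b.
Proof.
rewrite -(odd_mod a (erefl : odd 8 = false)) -(odd_mod b (erefl : odd 8 = false)).
rewrite /two_char -modnMm; have := ltn_pmod a (isT : (0 < 8)%N).
have := ltn_pmod b (isT : (0 < 8)%N); move: (a %% 8)%N (b %% 8)%N => {}a {}b.
case: a => [|[|[|[|[|[|[|[|?]]]]]]]] //; case: b => [|[|[|[|[|[|[|[|?]]]]]]]] //.
Qed.

(** Divided by 4, this compares the exponent (n^2 - 1) / 4 modulo 4 with twice the
    parity [two_char n]. *)
Lemma sqr_mod16 (n : nat) : odd n ->
  exists k, (n ^ 2 = 1 + 8 * two_char n + 16 * k)%N.
Proof.
move=> on; have nE := divn_eq n 8; set q := (n %/ 8)%N in nE.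
have := odd_mod n (erefl : odd 8 = false); rewrite on /two_char.
have := ltn_pmod n (isT : (0 < 8)%N); move: (n %% 8)%N nE => r ->.
case: r => [|[|[|[|[|[|[|[|]]]]]]]] // _ _ /=.
- by exists (4 * q ^ 2 + q)%N; ring.
- by exists (4 * q ^ 2 + 3 * q)%N; ring.
- by exists (4 * q ^ 2 + 5 * q + 1)%N; ring.
by exists (4 * q ^ 2 + 7 * q + 3)%N; ring.
Qed.

Definition three_mod4 (n : nat) : bool := (n %% 4 == 3)%N.

Lemma three_mod4M a b : odd a -> odd b ->
  three_mod4 (a * b) = three_mod4 a (+) three_mod4 b.
Proof.
rewrite -(odd_mod a (erefl : odd 4 = false)) -(odd_mod b (erefl : odd 4 = false)).
rewrite /three_mod4 -modnMm; have := ltn_pmod a (isT : (0 < 4)%N).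
have := ltn_pmod b (isT : (0 < 4)%N); move: (a %% 4)%N (b %% 4)%N => {}a {}b.
by case: a => [|[|[|[|?]]]] //; case: b => [|[|[|[|?]]]] //.
Qed.

Lemma half_pred_parity d : odd d -> odd ((d - 1) %/ 2) = three_mod4 d.
Proof.
move=> d_odd; rewrite /three_mod4; have := divn_eq d 4.
have := odd_mod d (erefl : odd 4 = false); rewrite d_odd.
have := ltn_pmod d (isT : (0 < 4)%N); move: (d %/ 4)%N => q.
case: (d %% 4)%N => [|[|[|[|]]]] // _ _ ->.
  by rewrite addn1 subn1 /= -[4%N]/(2 * 2)%N mulnA mulnK // oddM andbF.
have -> : (q * 4 + 3 - 1 = (q * 2).*2 + 2)%N by lia.
by rewrite -muln2 divnDr // mulnK // oddD oddM andbF.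
Qed.

Lemma prime_mul_ind (P : nat -> Prop) : P 1%N ->
  (forall l n, prime l -> (0 < n)%N -> P n -> P (l * n)%N) ->
  forall n, (0 < n)%N -> P n.
Proof.
move=> P1 PM; elim/ltn_ind => n IH n0.
have [n1|n1] := leqP n 1; first by have -> : n = 1%N by apply/eqP; rewrite eqn_leq n1.
have lP := pdiv_prime n1; have /dvdnP[k nE] := pdiv_dvd n.
have k0 : (0 < k)%N by move: n0; rewrite nE muln_gt0 => /andP[].
rewrite nE mulnC; apply: PM => //; apply: IH => //.
by rewrite [X in (_ < X)%N]nE ltn_Pmulr // prime_gt1.
Qed.

Lemma squarefree_ndvd l n N : prime l -> squarefree N -> (l * n %| N)%N -> ~~ (l %| n)%N.
Proof.
move=> l_pr N_sf lnN; apply/negP => ln; have l1 : l = 1%N.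
  by apply: N_sf; apply: dvdn_trans lnN; rewrite -mulnn dvdn_mul.
by move: l_pr; rewrite l1.
Qed.

Lemma perm_primes_mul a b : (0 < a)%N -> (0 < b)%N -> coprime a b ->
  perm_eq (primes (a * b)) (primes a ++ primes b).
Proof.
move=> a0 b0 ab; apply: uniq_perm; rewrite ?primes_uniq //.
  rewrite cat_uniq !primes_uniq andbT; apply/hasPn => q.
  rewrite !mem_primes => /and3P[q_pr _ qb]; apply/negP => /and3P[_ _ qa].
  have : (q %| gcdn a b)%N by rewrite dvdn_gcd qa.
  by rewrite (eqP ab) dvdn1 => /eqP q1; rewrite q1 in q_pr.
by move=> q; rewrite primesM // mem_cat.
Qed.

Lemma perm_primes_prime_mul l n : prime l -> (0 < n)%N -> ~~ (l %| n)%N ->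
  perm_eq (primes (l * n)) (l :: primes n).
Proof.
move=> l_pr n0 ln; have := @perm_primes_mul l n (prime_gt0 l_pr) n0.
by rewrite (prime_coprime _ l_pr) (primes_prime l_pr) => H; apply: H.
Qed.

Lemma prod_primes (n : nat) : (0 < n)%N -> squarefree n ->
  (\prod_(q <- primes n) q)%N = n.
Proof.
move=> n0 n_sf; suff : forall k, (0 < k)%N -> (k %| n)%N -> (\prod_(q <- primes k) q)%N = k.
  by apply; rewrite ?dvdnn.
apply: prime_mul_ind => [_|l k l_pr k0 IH lkn]; first by rewrite big_nil.
rewrite (perm_big _ (perm_primes_prime_mul l_pr k0 (squarefree_ndvd l_pr n_sf lkn))).
by rewrite big_cons IH //; apply: dvdn_trans lkn; exact: dvdn_mull.
Qed.

Lemma odd_primes n q : odd n -> q \in primes n -> odd q.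
Proof. by move=> n_odd; rewrite mem_primes => /and3P[_ _ qn]; exact: dvdn_odd qn n_odd. Qed.

(** A prime is 1 modulo 4 when it is 1 or 5 modulo 8, and the product n of its
    distinct odd prime factors is 3 modulo 4 when an odd number of them is. *)
Lemma nprimes_mod8_parity n : (0 < n)%N -> odd n -> squarefree n ->
  odd (nprimes_mod8 1 n + nprimes_mod8 5 n) = odd (nprimes n + three_mod4 n).
Proof.
move=> n0 n_odd n_sf; rewrite -{4}(prod_primes n0 n_sf) /nprimes_mod8 /nprimes.
have : all odd (primes n) by apply/allP => q; exact: odd_primes.
elim: (primes n) => [|q s IH] /=; first by rewrite big_nil.
case/andP=> q_odd s_odd; have {}IH := IH s_odd; rewrite big_cons.
have P_odd : odd (\prod_(j <- s) j) by elim: s s_odd {IH} => [|j s IH] /=;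
  [rewrite big_nil | case/andP=> jo /IH; rewrite big_cons oddM jo].
rewrite three_mod4M // !oddD oddb; move: IH; rewrite !oddD oddb.
have -> : three_mod4 q = ~~ ((q %% 8 == 1) || (q %% 8 == 5))%N.
  rewrite /three_mod4 -(modn_dvdm q (isT : 4 %| 8)%N).
  have := odd_mod q (erefl : odd 8 = false); rewrite q_odd.
  by have := ltn_pmod q (isT : (0 < 8)%N); case: (q %% 8)%N => [|[|[|[|[|[|[|[|]]]]]]]].
have : ~~ ((q %% 8 == 1) && (q %% 8 == 5))%N by case: eqP => // ->.
case: (q %% 8 == 1)%N; case: (q %% 8 == 5)%N => //= _; rewrite ?add0n ?add1n /=;
by case: (odd _) => //=; case: (odd _) => //=; case: (odd _) => //=; case: (three_mod4 _).
Qed.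

Lemma tauM a b : (0 < a)%N -> (0 < b)%N -> coprime a b -> tau (a * b) = (tau a * tau b)%N.
Proof.
by move=> a0 b0 ab; rewrite /tau (perm_big _ (perm_primes_mul a0 b0 ab)) big_cat.
Qed.

(** * Powers of a square root of -1 *)

(** Real part of the k-th power of i; [im4] is its imaginary part. *)
Definition re4 (k : nat) : int := nth 0 [:: 1; 0; -1; 0] (k %% 4).

Definition im4 (k : nat) : int := nth 0 [:: 0; 1; 0; -1] (k %% 4).

Lemma re4_mod k : re4 (k %% 4)%N = re4 k.
Proof. by rewrite /re4 modn_mod. Qed.

Lemma im4_mod k : im4 (k %% 4)%N = im4 k.
Proof. by rewrite /im4 modn_mod. Qed.

(** Both re + im and (-1)^l are signs, and the product of two signs s, t is
    s + t - 1 modulo 4. *)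
Lemma re4im4_twist k l : re4 (k + 2 * l)%N + im4 (k + 2 * l)%N =
  re4 k + im4 k + (-1) ^+ l - 1 + 4 * ((2 <= k %% 4)%N && odd l)%:R.
Proof.
rewrite -re4_mod -im4_mod -modnDml -[(k %% 4 + _)%N]addnC -modnDml mod4_double.
rewrite -signr_odd -[re4 k]re4_mod -[im4 k]im4_mod.
have : (k %% 4 < 4)%N by rewrite ltn_mod.
by case: (odd l); case: (k %% 4)%N => [|[|[|[|]]]].
Qed.

Lemma im4_twist k l :
  im4 (k + 2 * l)%N = (odd k)%:R - 2 * (((k %% 4 == 3)%N (+) odd l) && odd k)%:R.
Proof.
rewrite -im4_mod -modnDml -[(k %% 4 + _)%N]addnC -modnDml mod4_double.
rewrite -[odd k](odd_mod k (erefl : odd 4 = false)).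
have : (k %% 4 < 4)%N by rewrite ltn_mod.
by case: (odd l); case: (k %% 4)%N => [|[|[|[|]]]].
Qed.

Lemma re4_half k : re4 (k + 2) = - re4 k.
Proof.
rewrite -re4_mod -modnDml -[in RHS]re4_mod.
by have := ltn_pmod k (isT : (0 < 4)%N); case: (k %% 4)%N => [|[|[|[|]]]].
Qed.

Section FourthRoots.
Variables (K : fieldType) (j : K).
Hypothesis j2 : j ^+ 2 = -1.

Lemma sqrtN1_X4 : j ^+ 4 = 1.
Proof. by rewrite (exprM _ 2 2) j2 sqrrN expr1n. Qed.

Lemma sqrtN1_neq0 : j != 0.
Proof. by have := oner_neq0 K; rewrite -sqrtN1_X4 expf_eq0. Qed.

Lemma expr_mod4 k : j ^+ (k %% 4) = j ^+ k.
Proof. exact/expr_mod/sqrtN1_X4. Qed.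

Lemma expr_re4im4 k : j ^+ k = (re4 k)%:~R + (im4 k)%:~R * j.
Proof.
rewrite -expr_mod4 /re4 /im4; have : (k %% 4 < 4)%N by rewrite ltn_mod.
case: (k %% 4)%N => [|[|[|[|//]]]] _ /=; rewrite ?expr0 ?expr1 ?j2.
- by rewrite mul0r addr0.
- by rewrite mul1r add0r.
- by rewrite mul0r addr0.
by rewrite exprS j2 mulrN1 add0r rmorphN1 mulN1r.
Qed.

Lemma sqrtN1_opp : (- j) ^+ 2 = -1.
Proof. by rewrite sqrrN. Qed.

Lemma sqrtN1_X3 : j ^+ 3 = - j.
Proof. by rewrite exprS j2 mulrN1. Qed.

Hypothesis two_neq0 : 2 != 0 :> K.

Lemma N1_neq1 : -1 != 1 :> K.
Proof. by rewrite eq_sym -subr_eq0 opprK. Qed.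

Lemma sqrtN1_primitive : 4.-primitive_root j.
Proof.
have [m pm m4] := prim_order_exists (isT : (0 < 4)%N) sqrtN1_X4.
have m_gt0 := prim_order_gt0 pm; have im := prim_expr_order pm.
have m12 : ~~ (m %| 2)%N.
  apply/negP => m2; have /eqP := N1_neq1; apply; rewrite -j2.
  by rewrite -(divnK m2) mulnC exprM im expr1n.
suff -> : 4%N = m by [].
by case: m m4 m_gt0 m12 {pm im} => [|[|[|[|[|m]]]]] // /dvdn_leq; apply.
Qed.

Lemma eq_sqrtN1_expr a b : (j ^+ a == j ^+ b) = (a == b %[mod 4]).
Proof. exact/eq_prim_root_expr/sqrtN1_primitive. Qed.

(** The logarithm modulo 4 in base a primitive fourth root of unity. *)
Definition log4 (z : K) : nat := index z [seq j ^+ i | i <- iota 0 4].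

Lemma log4P z : z ^+ 4 = 1 -> z = j ^+ log4 z.
Proof.
case/(prim_rootP sqrtN1_primitive) => i E.
have zin : z \in [seq j ^+ i | i <- iota 0 4].
  by rewrite E; apply: map_f; rewrite mem_iota /=.
have lt4 : (log4 z < 4)%N by move: zin; rewrite -index_mem size_map size_iota.
by rewrite -[LHS](nth_index 0 zin) (nth_map 0%N) ?size_iota // nth_iota.
Qed.

End FourthRoots.

(** * Gauss and Jacobi sums over a finite field *)

Section GaussSums.
Variables (F : finFieldType) (K : fieldType).

(** Extended by 0 at 0, so that sums over F need no side condition. *)
Definition mulchar (c : F -> K) : Prop :=
  [/\ c 0 = 0, c 1 = 1 & {morph c : x y / x * y}].

Definition nontrivial (c : F -> K) : Prop := exists2 t, t != 0 & c t != 1.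

Lemma mulchar_neq0 (c : F -> K) t : mulchar c -> t != 0 -> c t != 0.
Proof.
case=> c0 c1 cM t0; apply/eqP => ct; have := cM t t^-1.
by rewrite divff // c1 ct mul0r => /eqP; rewrite oner_eq0.
Qed.

Lemma mulchar_mul (c d : F -> K) :
  mulchar c -> mulchar d -> mulchar (fun t => c t * d t).
Proof.
case=> c0 c1 cM [d0 d1 dM]; split; rewrite ?c0 ?c1 ?mul0r ?d1 ?mulr1 // => x y.
by rewrite cM dM mulrACA.
Qed.

Lemma reindex_mulf (a : F) (G : F -> K) : a != 0 ->
  \sum_t G t = \sum_t G (a * t).
Proof.
move=> a0; rewrite (reindex_inj (h := fun t => a * t)) //.
exact: mulfI.
Qed.

Lemma sum_mulchar (c : F -> K) : mulchar c -> nontrivial c -> \sum_t c t = 0.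
Proof.
move=> [_ _ cM] [a a0 ca]; set S := \sum_t _.
have : S = c a * S.
  by rewrite {1}/S (reindex_mulf _ a0) mulr_sumr; apply: eq_bigr => t _.
move/eqP; rewrite -subr_eq0 -{1}[S]mul1r -mulrBl mulf_eq0 subr_eq0 eq_sym.
by rewrite (negPf ca) => /eqP.
Qed.

Definition addchar (psi : F -> K) : Prop :=
  [/\ psi 0 = 1, {morph psi : x y / x + y >-> x * y} & \sum_t psi t = 0].

Definition gauss (psi c : F -> K) : K := \sum_t c t * psi t.

Definition jacobi (c d : F -> K) : K := \sum_t c t * d (1 - t).

Variable psi : F -> K.
Hypothesis psiP : addchar psi.

Lemma sum_addchar (u : F) : \sum_t psi (u * t) = (u == 0)%:R * #|F|%:R.
Proof.
case: psiP => psi0 _ psiS; case: eqVneq => [->|u0].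
  rewrite mul1r (eq_bigr (fun _ => 1)) ?sumr_const // => t _.
  by rewrite mul0r psi0.
by rewrite mul0r -(reindex_mulf _ u0).
Qed.

Lemma gauss_scale (c : F -> K) a : mulchar c -> a != 0 ->
  \sum_t c t * psi (a * t) = (c a)^-1 * gauss psi c.
Proof.
move=> cc a0; have ca := mulchar_neq0 cc a0; case: cc => _ _ cM.
apply: (mulfI ca); rewrite mulrA divff // mul1r /gauss [RHS](reindex_mulf _ a0).
by rewrite mulr_sumr; apply: eq_bigr => t _; rewrite cM mulrA.
Qed.

Lemma gauss_mul_gauss (c d : F -> K) : gauss psi c * gauss psi d =
  \sum_u psi u * \sum_s c s * d (u - s).
Proof.
case: psiP => _ psiD _.
rewrite /gauss big_distrl /=.
under [RHS]eq_bigr do rewrite mulr_sumr.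
rewrite exchange_big; apply: eq_bigr => s _ /=.
rewrite mulr_sumr (reindex_inj (h := fun u => u - s)) /=; last exact: addIr.
apply: eq_bigr => u _; have -> : psi u = psi s * psi (u - s).
  by rewrite -psiD addrC subrK.
by rewrite mulrACA [RHS]mulrC.
Qed.

(** Grouping the terms of the double sum by [s + t = u], each [u != 0]
    contributes a Jacobi sum and [u = 0] vanishes. *)
Lemma gaussM (c d : F -> K) : mulchar c -> mulchar d ->
  nontrivial (fun t => c t * d t) ->
  gauss psi c * gauss psi d = jacobi c d * gauss psi (fun t => c t * d t).
Proof.
move=> cc dd ntcd; rewrite gauss_mul_gauss /gauss mulr_sumr.
have cdS := sum_mulchar (mulchar_mul cc dd) ntcd.
apply: eq_bigr => u _; case: (cc) (dd) => c0 _ cM [d0 _ dM].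
have [->|u0] := eqVneq u 0; last first.
  rewrite (reindex_mulf _ u0).
  have -> : \sum_s c (u * s) * d (u - u * s) = c u * d u * jacobi c d.
    rewrite /jacobi mulr_sumr; apply: eq_bigr => s _.
    by rewrite -{2}[u]mulr1 -mulrBr cM dM mulrACA.
  by ring.
rewrite c0 !mul0r mulr0 (eq_bigr (fun s => d (-1) * (c s * d s))).
  by rewrite -mulr_sumr cdS !mulr0.
by move=> s _; rewrite sub0r -[- s]mulN1r dM mulrCA.
Qed.

(** With s = t r the double sum groups by r = s / t, where the inner sum over t of an
    additive character vanishes up to its term at 0 unless r = -1. *)
Lemma gaussMV (c d : F -> K) : mulchar c -> mulchar d -> nontrivial c ->
  (forall t, t != 0 -> c t * d t = 1) ->
  gauss psi c * gauss psi d = c (-1) * #|F|%:R.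
Proof.
move=> cc dd ntc cdE; have cS := sum_mulchar cc ntc.
case: (cc) (dd) => c0 _ cM [d0 _ dM].
case: psiP => psi0 psiD _.
have -> : gauss psi c * gauss psi d =
    \sum_t \sum_(s | s != 0) c (s * t) * d s * psi ((t + 1) * s).
  rewrite /gauss mulrC mulr_suml (bigID (pred1 0)) /= big_pred1_eq d0 !mul0r.
  rewrite add0r exchange_big /=; apply: eq_bigr => s s0.
  rewrite mulr_sumr (reindex_mulf _ s0); apply: eq_bigr => t _.
  rewrite mulrDl mul1r psiD [t * s]mulrC; ring.
have E t : \sum_(s | s != 0) c (s * t) * d s * psi ((t + 1) * s) =
    c t * ((t == -1)%:R * #|F|%:R - 1).
  rewrite -addr_eq0 -sum_addchar [in RHS](bigD1 0) //= mulr0 psi0 [1 + _]addrC addrK.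
  rewrite mulr_sumr; apply: eq_bigr => s s0.
  by rewrite cM -[c s * _ * _]mulrA mulrCA cdE // mulr1.
under eq_bigr do rewrite E mulrBr mulr1.
rewrite sumrB cS subr0 (bigD1 (-1)) //= eqxx mul1r big1 ?addr0 // => t /negPf->.
by rewrite mul0r mulr0.
Qed.

End GaussSums.

(** * The quartic character of a finite field *)

Lemma exists_expf_neq1 (F : finFieldType) (k : nat) :
  (0 < k)%N -> (k < #|F|.-1)%N -> exists2 t : F, t != 0 & t ^+ k != 1.
Proof.
move=> k0 kF; apply: contrapT => H.
have H1 (t : F) : t != 0 -> t ^+ k = 1.
  by move=> t0; apply/eqP; apply: contrapT => /negP tk; apply: H; exists t.
have := @max_poly_roots _ ('X^k - 1) [seq t <- enum F | t != 0].
have -> : size [seq t <- enum F | t != 0] = #|F|.-1.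
  rewrite size_filter [in RHS]cardE -(count_predC (pred1 0)).
  by rewrite count_uniq_mem ?enum_uniq // mem_enum.
rewrite size_XnsubC // -size_poly_eq0 size_XnsubC //.
have -> : all (root ('X^k - 1)) [seq t <- enum F | t != 0].
  apply/allP => t; rewrite mem_filter => /andP[/H1 E _].
  by rewrite rootE !hornerE E subrr.
by move=> /(_ isT isT); rewrite filter_uniq ?enum_uniq // => /(_ isT); lia.
Qed.

Section QuarticCharacter.
Variables (F : finFieldType) (f : F).
Hypothesis cardF : (#|F| %% 4 = 1)%N.
Hypothesis f2 : f ^+ 2 = -1.

Local Notation n4 := (#|F|.-1 %/ 4)%N.

Lemma card_n4 : #|F| = (4 * n4).+1.
Proof.
have := cardF; have := divn_eq #|F| 4; move: #|F| => c; lia.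
Qed.

Lemma card_F_sub1 : (4 * n4)%N = #|F|.-1.
Proof. by rewrite [in RHS]card_n4. Qed.

Lemma n4_gt0 : (0 < n4)%N.
Proof.
have := card_n4; have := finNzRing_gt1 F; case: n4 => //.
by rewrite muln0 => h1 h2; rewrite h2 in h1.
Qed.

Lemma F_two_neq0 : 2 != 0 :> F.
Proof.
apply/eqP => two0; have : (#|F|%:R : F) = 0.
  apply: (addrI (\sum_(t : F) t)).
  rewrite addr0 [in RHS](reindex_inj (addIr 1)) big_split /=.
  by rewrite sumr_const.
rewrite card_n4 -addn1 natrD (natrM _ 4) (natrM _ 2 2) two0 !mul0r add0r.
by move/eqP; rewrite oner_eq0.
Qed.

Lemma f_neq0 : f != 0. Proof. exact: sqrtN1_neq0 f2. Qed.

Lemma expf_card_sub1 (t : F) : t != 0 -> t ^+ (4 * n4) = 1.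
Proof.
move=> t0; apply: (mulIf t0); rewrite mul1r -exprSr -card_n4; exact: expf_card.
Qed.

(** The quartic character of F as an exponent: t is sent to i to the power
    [qexp t], where i corresponds to the square root f of -1. *)
Definition qexp (t : F) : nat := log4 f (t ^+ n4).

Lemma qexpP t : t != 0 -> t ^+ n4 = f ^+ qexp t.
Proof.
move=> t0; apply: (log4P f2 F_two_neq0).
by rewrite -exprM mulnC expf_card_sub1.
Qed.

Lemma qexp_eq t k : t != 0 -> t ^+ n4 = f ^+ k -> qexp t = k %[mod 4].
Proof.
move=> t0; rewrite qexpP // => /eqP.
by rewrite (eq_sqrtN1_expr f2 F_two_neq0) => /eqP.
Qed.

Lemma qexpM s t : s != 0 -> t != 0 -> qexp (s * t) = qexp s + qexp t %[mod 4].
Proof.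
move=> s0 t0; apply: qexp_eq; first by rewrite mulf_neq0.
by rewrite exprMn !qexpP // exprD.
Qed.

Lemma qexpX t k : t != 0 -> qexp (t ^+ k) = k * qexp t %[mod 4].
Proof.
move=> t0; apply: qexp_eq; first by rewrite expf_neq0.
by rewrite -exprM mulnC exprM qexpP // -exprM mulnC.
Qed.

Lemma qexp1 : qexp 1 = 0 %[mod 4].
Proof. by apply: qexp_eq; rewrite ?oner_neq0 // expr1n. Qed.

Lemma qexpN1 : qexp (-1) = 2 * n4 %[mod 4].
Proof.
by apply: qexp_eq; rewrite ?oppr_eq0 ?oner_neq0 // -f2 -exprM.
Qed.

Lemma odd_qexpN t : t != 0 -> odd (qexp (- t)) = odd (qexp t).
Proof.
move=> t0; have N10 : -1 != 0 :> F by rewrite oppr_eq0 oner_neq0.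
have := odd_eqmod4 (qexpM N10 t0); rewrite mulN1r => ->.
by rewrite oddD (odd_eqmod4 qexpN1) oddM.
Qed.

Lemma exists_qexp_odd : exists2 t, t != 0 & odd (qexp t).
Proof.
have k0 : (0 < 2 * n4)%N by rewrite muln_gt0 n4_gt0.
have kF : (2 * n4 < #|F|.-1)%N.
  by have := card_F_sub1; have := n4_gt0; move: n4 (#|F|.-1) => a b; lia.
have [t t0 t1] := exists_expf_neq1 k0 kF; exists t => //.
apply: contraR t1 => /even_halfK even_t; apply/eqP.
rewrite mulnC exprM qexpP // -exprM -even_t.
by rewrite -mul2n mulnAC exprM (sqrtN1_X4 f2) expr1n.
Qed.

End QuarticCharacter.

Section QuarticJacobi.
Variables (F : finFieldType) (f : F).
Hypothesis cardF : (#|F| %% 4 = 1)%N.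
Hypothesis f2 : f ^+ 2 = -1.
Local Notation e := (qexp f).

(** The quartic character with values in any field with a square root j of -1.
    Characteristic 0 gives the absolute value of its Jacobi sum, F itself the
    prime ideal that it generates, and characteristic q its reciprocity with q. *)
Definition qchar (K : fieldType) (j : K) (t : F) : K :=
  if t == 0 then 0 else j ^+ e t.

Definition qchar2 (K : fieldType) (j : K) (t : F) : K := qchar j t * qchar j t.

Lemma qcharE (K : fieldType) (j : K) t : t != 0 -> qchar j t = j ^+ e t.
Proof. by rewrite /qchar => /negPf ->. Qed.

Section Characters.
Variables (K : fieldType) (j : K).
Hypothesis j2 : j ^+ 2 = -1.

Lemma jexp_mod a b : a = b %[mod 4] -> j ^+ a = j ^+ b.
Proof. by move=> E; rewrite -(expr_mod4 j2) E expr_mod4. Qed.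

Lemma qchar_mulchar : mulchar (qchar j).
Proof.
split; rewrite /qchar ?eqxx // ?oner_eq0; first exact: jexp_mod (qexp1 cardF f2).
move=> s t; rewrite mulf_eq0.
have [->|s0] /= := eqVneq s 0; first by rewrite mul0r.
have [_|t0] := eqVneq t 0; first by rewrite mulr0.
by rewrite -exprD; apply/jexp_mod/(qexpM cardF f2).
Qed.

Lemma qchar2E t : t != 0 -> qchar2 j t = (-1) ^+ e t.
Proof. by move=> t0; rewrite /qchar2 !qcharE // -exprMn -expr2 j2. Qed.

Lemma qchar2_mulchar : mulchar (qchar2 j).
Proof. by apply: mulchar_mul; apply: qchar_mulchar. Qed.

Lemma qchar2N1 : qchar2 j (-1) = 1.
Proof. by rewrite /qchar2; case: qchar_mulchar => _ q1 <-; rewrite mulrNN mulr1. Qed.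

Lemma qchar_qchar2 t : qchar j t * qchar2 j t = qchar (- j) t.
Proof.
rewrite /qchar2 /qchar; case: eqP => _; first by rewrite mul0r.
by rewrite -!exprMn -expr2 -exprS (sqrtN1_X3 j2).
Qed.

Lemma qcharNK t : t != 0 -> qchar j t * qchar (- j) t = 1.
Proof.
move=> t0; rewrite !qcharE // -exprMn mulrN -expr2 j2 opprK expr1n //.
Qed.

Hypothesis two_neq0 : 2 != 0 :> K.

Lemma qchar_nontrivial : nontrivial (qchar j).
Proof.
have [t t0 ot] := exists_qexp_odd cardF f2; exists t => //.
rewrite qcharE // -[1](expr0 j) (eq_sqrtN1_expr j2 two_neq0).
by apply/eqP => /(congr1 odd); rewrite !odd_mod // ot.
Qed.

Lemma qchar2_nontrivial : nontrivial (qchar2 j).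
Proof.
have [t t0 ot] := exists_qexp_odd cardF f2; exists t => //.
by rewrite qchar2E // -signr_odd ot expr1 N1_neq1.
Qed.

End Characters.

Lemma qchar2_opp (K : fieldType) (j : K) t : j ^+ 2 = -1 ->
  qchar2 (- j) t = qchar2 j t.
Proof.
move=> j2; rewrite /qchar2 /qchar; case: eqP => // _.
by rewrite -!exprMn mulrNN.
Qed.

(** [primary_re] + [primary_im] i is - J(chi, chi^2), defined through integers so that
    it specializes to every field. *)
Definition primary_re : int :=
  - \sum_(s : F | (s != 0) && (s != 1)) re4 (e s + 2 * e (1 - s)%R)%N.
Definition primary_im : int :=
  - \sum_(s : F | (s != 0) && (s != 1)) im4 (e s + 2 * e (1 - s)%R)%N.

Lemma jacobi_qchar (K : fieldType) (j : K) : j ^+ 2 = -1 ->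
  jacobi (qchar j) (qchar2 j) = - (primary_re%:~R + primary_im%:~R * j).
Proof.
move=> j2; rewrite /jacobi (bigID (fun s => (s != 0) && (s != 1))) /=.
rewrite [X in _ + X]big1 ?addr0; last first.
  move=> s; rewrite negb_and !negbK => /orP[] /eqP ->.
    by rewrite /qchar eqxx mul0r.
  by rewrite subrr /qchar2 /qchar eqxx !mulr0.
rewrite /primary_re /primary_im !rmorphN mulNr -opprD opprK !raddf_sum mulr_suml -big_split.
apply: eq_bigr => s /andP[s0 s1] /=.
rewrite qcharE // /qchar2 qcharE ?subr_eq0 1?eq_sym //.
by rewrite -!exprD addnn -mul2n -expr_re4im4.
Qed.

End QuarticJacobi.

(** * The primary Jacobi sum *)

Section Primary.
Variables (F : finFieldType) (f : F).
Hypothesis cardF : (#|F| %% 4 = 1)%N.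
Hypothesis f2 : f ^+ 2 = -1.
Local Notation e := (qexp f).

(** Multiplication by t0 permutes the nonzero s and changes the sign of the sum. *)
Lemma sum_qexp_eq0 (G : nat -> int) (t0 : F) : t0 != 0 ->
  (forall k l, k = l %[mod 4] -> G k = G l) ->
  (forall k, G (e t0 + k)%N = - G k) -> \sum_(s : F | s != 0) G (e s) = 0.
Proof.
move=> t00 Gmod GN; set S := \sum_(s | _) _.
suff : S = - S by lia.
rewrite {1}/S (reindex_inj (mulfI t00)) /= -sumrN.
rewrite (eq_bigl (fun s => s != 0)) => [|s]; last by rewrite mulf_eq0 negb_or t00.
apply: eq_bigr => s s0.
by rewrite (Gmod _ _ (qexpM cardF f2 t00 s0)) GN.
Qed.

Lemma sum_sign_qexp : \sum_(s : F | s != 0) ((-1) ^+ e s : int) = 0.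
Proof.
have [t t0 ot] := exists_qexp_odd cardF f2.
apply: (sum_qexp_eq0 (G := fun k => (-1) ^+ k) t0) => [k l E|k].
  by rewrite -signr_odd -(odd_mod k (erefl : odd 4 = false)) E odd_mod // signr_odd.
by rewrite exprD -[_ ^+ e t]signr_odd ot expr1 mulN1r.
Qed.

Lemma sum_re4im4_qexp : \sum_(s : F | s != 0) (re4 (e s) + im4 (e s)) = 0.
Proof.
have [t t0 ot] := exists_qexp_odd cardF f2.
apply: (sum_qexp_eq0 (G := fun k => re4 k + im4 k) (t0 := t ^+ 2)).
- by rewrite expf_neq0.
- by move=> k l E; rewrite -re4_mod -im4_mod E re4_mod im4_mod.
move=> k; rewrite -re4_mod -im4_mod -modnDml (qexpX cardF f2 2 t0) modnDml.
by rewrite re4_mod im4_mod addnC re4im4_twist -signr_odd ot /=; 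
  rewrite -[re4 k]re4_mod -[im4 k]im4_mod;
  have : (k %% 4 < 4)%N by [rewrite ltn_mod]; case: (k %% 4)%N => [|[|[|[|]]]].
Qed.

Lemma sum_except1 (G : F -> int) :
  \sum_(s | (s != 0) && (s != 1)) G s = \sum_(s | s != 0) G s - G 1.
Proof.
by rewrite [in RHS](bigD1 1) ?oner_neq0 //= addrC addrK.
Qed.

Lemma sum_except1_reflect (G : F -> int) :
  \sum_(s | (s != 0) && (s != 1)) G (1 - s) = \sum_(s | (s != 0) && (s != 1)) G s.
Proof.
rewrite (reindex_inj (h := fun s : F => 1 - s)) /=; last first.
  by move=> x y /addrI/oppr_inj.
apply: eq_big => [s|s _]; last by rewrite opprB addrC subrK.
have -> : (1 - s == 1) = (s == 0) by rewrite -subr_eq0 addrAC subrr add0r oppr_eq0.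
by rewrite subr_eq0 eq_sym andbC.
Qed.

Lemma sum_neq0_1 : \sum_(s : F | s != 0) (1 : int) = 4 * (#|F|.-1 %/ 4)%N%:Z.
Proof.
have -> : \sum_(s : F | s != 0) (1 : int) = \sum_(s : F) 1 - 1.
  by rewrite [X in _ = X - 1](bigD1 0) //= addrC addrK.
by rewrite sumr_const [X in _ *+ X](card_n4 cardF) mulrSr addrK natrM !natz.
Qed.

Lemma qexp1_mod4 : (e 1%R %% 4)%N = 0%N.
Proof. exact: qexp1 cardF f2. Qed.

(** The Jacobi sum is a sum of products of two signs in the coordinate re + im,
    and each of these signs has sum 0 over the nonzero elements. Together with
    [primary_im_even] this says that a + b i is 1 modulo 2 + 2 i. *)
Lemma primary_mod4 : exists k, primary_re f + primary_im f = 1 + 4 * k.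
Proof.
exists ((#|F|.-1 %/ 4)%N%:Z - \sum_(s : F | (s != 0) && (s != 1))
   ((2 <= e s %% 4)%N && odd (e (1 - s)%R))%:R).
rewrite /primary_re /primary_im -opprD -big_split /=.
set T := \sum_(s | _) (_ && _)%:R.
have -> : \sum_(s | (s != 0) && (s != 1))
    (re4 (e s + 2 * e (1 - s)%R)%N + im4 (e s + 2 * e (1 - s)%R)%N) =
  \sum_(s | (s != 0) && (s != 1)) (re4 (e s) + im4 (e s)) +
  \sum_(s | (s != 0) && (s != 1)) (-1) ^+ e (1 - s) -
  \sum_(s : F | (s != 0) && (s != 1)) 1 + 4 * T.
  rewrite /T mulr_sumr -big_split -sumrB -big_split /=.
  by apply: eq_bigr => s _; rewrite re4im4_twist.
rewrite (sum_except1 (fun s => re4 (e s) + im4 (e s))) /= sum_re4im4_qexp.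
rewrite (sum_except1_reflect (fun s => (-1) ^+ e s)).
rewrite (sum_except1 (fun s => (-1) ^+ e s)) sum_sign_qexp.
rewrite (sum_except1 (fun=> 1)) sum_neq0_1 -re4_mod -im4_mod -signr_odd.
by rewrite -(odd_mod (e 1) (erefl : odd 4 = false)) qexp1_mod4 /=; ring.
Qed.

(** A term of the sum is odd when s is not a square, which happens for half of the
    nonzero s, an even number. *)
Lemma primary_im_even : exists k, primary_im f = 2 * k.
Proof.
rewrite /primary_im; under eq_bigr do rewrite im4_twist.
rewrite sumrB -mulr_sumr.
have -> : \sum_(s | (s != 0) && (s != 1)) ((odd (e s))%:R : int) =
          2 * (#|F|.-1 %/ 4)%N%:Z.
  rewrite (sum_except1 (fun s => (odd (e s))%:R)) /=.
  rewrite -(odd_mod (e 1) (erefl : odd 4 = false)) qexp1_mod4 /= subr0.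
  apply: (@mulfI _ 2) => //; rewrite mulrA -sum_neq0_1 mulr_sumr.
  rewrite -[RHS]subr0 -[X in _ = _ - X]sum_sign_qexp -sumrB.
  by apply: eq_bigr => s _; rewrite -signr_odd; case: (odd _).
by rewrite -mulrBr -mulrN; eexists.
Qed.
End Primary.

Section PrimaryPrime.
Variables (F : finFieldType) (f : F).
Hypothesis cardF : (#|F| %% 4 = 1)%N.
Hypothesis f2 : f ^+ 2 = -1.
Local Notation e := (qexp f).
Local Notation n4 := (#|F|.-1 %/ 4)%N.

Lemma sum_expf (k : nat) : (k < #|F|.-1)%N -> \sum_(t : F) t ^+ k = 0.
Proof.
have [->|k0 kF] := posnP k => [_|].
  under eq_bigr do rewrite expr0.
  rewrite sumr_const; apply: (addrI (\sum_(t : F) t)).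
  by rewrite addr0 [in RHS](reindex_inj (addIr 1)) big_split /= sumr_const.
have mulX : mulchar (fun t : F => t ^+ k).
  by split; rewrite ?expr0n ?expr1n // ?(gtn_eqF k0) // => x y; rewrite exprMn.
by apply: (sum_mulchar mulX); exact: exists_expf_neq1.
Qed.

(** Over F itself chi is a power map, so that the Jacobi sum is a power sum of
    a polynomial of degree less than #|F| - 1. *)
Lemma primary_root : (primary_re f)%:~R + (primary_im f)%:~R * f = 0 :> F.
Proof.
apply/eqP; rewrite -oppr_eq0 -(jacobi_qchar f f2); apply/eqP.
have n40 := n4_gt0 cardF; have cF := card_n4 cardF.
have qE (t : F) : qchar f f t = t ^+ n4.
  rewrite /qchar; case: eqVneq => [->|t0]; first by rewrite expr0n (gtn_eqF n40).
  by rewrite (qexpP cardF f2).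
pose P : {poly F} := (1 - 'X) ^+ (n4 + n4).
have -> : jacobi (qchar f f) (qchar2 f f) =
          \sum_t \sum_(i < size P) P`_i * t ^+ (n4 + i).
  apply: eq_bigr => t _; rewrite /qchar2 !qE -exprD.
  have -> : (1 - t) ^+ (n4 + n4) = P.[t] by rewrite /P !hornerE.
  rewrite horner_coef mulr_sumr; apply: eq_bigr => i _.
  by rewrite mulrCA exprD.
rewrite exchange_big big1 //= => i _; rewrite -mulr_sumr sum_expf ?mulr0 //.
have : (size P <= (n4 + n4).+1)%N.
  rewrite /P; apply: leq_trans (size_poly_exp_leq _ _) _.
  have -> : size (1 - 'X : {poly F}) = 2%N.
    by rewrite -opprB size_polyN -['X - 1]/('X - 1%:P) size_XsubC.
  by rewrite mul1n.
have := ltn_ord i; have := card_F_sub1 cardF; move: n40.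
by move: n4 #|F| (size P) (nat_of_ord i) => a b c d; lia.
Qed.

Section Norm.
Variables (K : fieldType) (j : K) (psi : F -> K).
Hypothesis j2 : j ^+ 2 = -1.
Hypothesis two_neq0 : 2 != 0 :> K.
Hypothesis card_neq0 : #|F|%:R != 0 :> K.
Hypothesis psiP : addchar psi.

Let pi_ : K := (primary_re f)%:~R + (primary_im f)%:~R * j.
Let pi_bar : K := (primary_re f)%:~R - (primary_im f)%:~R * j.

Lemma gauss_qchar2_sqr : gauss psi (qchar2 f j) ^+ 2 = #|F|%:R.
Proof.
rewrite expr2 (gaussMV psiP) ?qchar2N1 ?mul1r //; try exact: qchar2_mulchar.
  exact: qchar2_nontrivial.
move=> t t0; rewrite !qchar2E // -exprMn mulrNN mulr1 expr1n //.
Qed.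

Lemma gauss_qchar_conj : gauss psi (qchar f j) * gauss psi (qchar f (- j)) =
  qchar f j (-1) * #|F|%:R.
Proof.
apply: gaussMV => //; try exact: qchar_mulchar.
- by apply: qchar_mulchar => //; exact: sqrtN1_opp.
- exact: qchar_nontrivial.
exact: qcharNK.
Qed.

Lemma gauss_qchar_neq0 : gauss psi (qchar f j) != 0.
Proof.
apply/eqP => g0; have := gauss_qchar_conj; rewrite g0 mul0r.
move/esym/eqP; rewrite mulf_eq0 (negPf card_neq0) orbF.
apply/negP/mulchar_neq0; first exact: qchar_mulchar.
by rewrite oppr_eq0 oner_neq0.
Qed.

Lemma gauss_qchar_qchar2 : gauss psi (qchar f j) * gauss psi (qchar2 f j) =
  - pi_ * gauss psi (qchar f (- j)).
Proof.
have qq2 : (fun t => qchar f j t * qchar2 f j t) = qchar f (- j).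
  by apply: funext => t; exact: qchar_qchar2.
have nt : nontrivial (qchar f (- j)).
  by apply: qchar_nontrivial => //; exact: sqrtN1_opp.
rewrite (gaussM psiP) ?qq2 // ?jacobi_qchar //.
- exact: qchar_mulchar.
- exact: qchar2_mulchar.
Qed.

(** As pi pibar = #|F|, this is g(chi)^4 = pi^3 pibar. It follows from
    g(chi) g(chi^2) = - pi g(chibar), g(chi) g(chibar) = chi(-1) #|F| and
    g(chi^2)^2 = #|F|. *)
Lemma gauss_qchar_X4 : gauss psi (qchar f j) ^+ 4 = pi_ ^+ 2 * #|F|%:R.
Proof.
have G1 := gauss_qchar_qchar2; have G2 := gauss_qchar_conj.
have G3 := gauss_qchar2_sqr; move: G1 G2 G3 card_neq0.
have : qchar f j (-1) ^+ 2 = 1 by rewrite expr2; exact: qchar2N1.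
move: (gauss _ _) (gauss _ _) (gauss _ _) (qchar f j (-1)) (#|F|%:R : K).
move=> gb h g c p c2 G1 G2 G3 p0; apply: (mulIf p0).
have -> : g ^+ 4 * p = g ^+ 2 * (g * h) ^+ 2 by rewrite -G3; ring.
have -> : pi_ ^+ 2 * p * p = (g * gb) ^+ 2 * pi_ ^+ 2.
  by rewrite G2 exprMn c2; ring.
by rewrite G1; ring.
Qed.

End Norm.

(** Applying g(chi) g(chi^2) = - pi g(chibar) to chi and then to chibar gives
    g(chi^2)^2 = pi pibar. *)
Lemma primary_norm_in (K : fieldType) (j : K) (psi : F -> K) :
  j ^+ 2 = -1 -> 2 != 0 :> K -> #|F|%:R != 0 :> K -> addchar psi ->
  ((primary_re f)%:~R + (primary_im f)%:~R * j) * ((primary_re f)%:~R - (primary_im f)%:~R * j)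
    = #|F|%:R.
Proof.
move=> j2 two0 card0 psiP.
have G1 := gauss_qchar_qchar2 j2 two0 psiP.
have := gauss_qchar_qchar2 (sqrtN1_opp j2) two0 psiP.
have -> : qchar2 f (- j) = qchar2 f j by apply: funext => t; exact: qchar2_opp.
rewrite opprK mulrN => G2.
have G3 := gauss_qchar2_sqr j2 two0 psiP.
have g0 := gauss_qchar_neq0 j2 two0 card0 psiP.
move: G1 G2 G3 g0; move: (gauss _ _) (gauss _ _) (gauss _ _) => gb h g G1 G2 <- g0.
apply: (mulIf g0).
have -> : h ^+ 2 * g = (g * h) * h by ring.
by rewrite G1 -[RHS]mulrA G2; ring.
Qed.

Lemma primary_norm (psi : F -> algC) : addchar psi ->
  primary_re f ^+ 2 + primary_im f ^+ 2 = #|F|%:Z.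
Proof.
move=> psiP; apply/eqP; rewrite -(eqr_int algC); apply/eqP.
have i2 : 'i ^+ 2 = -1 :> algC by exact: sqrCi.
rewrite -pmulrn -(primary_norm_in i2 _ _ psiP) ?pnatr_eq0 //; last first.
  by rewrite (card_n4 cardF).
rewrite mulrC -subr_sqr exprMn i2 mulrN1 opprK rmorphD !rmorphXn //.
Qed.

End PrimaryPrime.

(** * Biquadratic reciprocity for rational primes *)

Definition signed_prime (q : nat) : int := if (q %% 4 == 1)%N then q%:Z else - q%:Z.

(** The order of the group of values of pi / pibar modulo q: the units of the
    prime field when q = 1 mod 4, the elements of norm 1 of the quadratic
    extension when q = 3 mod 4. *)
Definition quot_order (q : nat) : nat := if (q %% 4 == 1)%N then q.-1 else q.+1.

(** The quotient is inverted when q = 3 modulo 4, where the exponent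
    (q' - 1) / 4 attached to q' = [signed_prime q] is negative. *)
Definition conj_quot (K : fieldType) (q : nat) (x y : K) : K :=
  if (q %% 4 == 1)%N then x / y else y / x.

Section Frobenius.
Variables (F : finFieldType) (f : F).
Hypothesis cardF : (#|F| %% 4 = 1)%N.
Hypothesis f2 : f ^+ 2 = -1.
Variables (K : fieldType) (j : K) (psi : F -> K) (q : nat).
Hypothesis j2 : j ^+ 2 = -1.
Hypothesis charK : q \in [pchar K].
Hypothesis q_odd : odd q.
Hypothesis card_neq0 : #|F|%:R != 0 :> K.
Hypothesis q_neq0 : q%:R != 0 :> F.
Hypothesis psiP : addchar psi.

Lemma odd_char_two_neq0 : 2 != 0 :> K.
Proof.
apply/eqP => two0.
have : 2%N \in [pchar K] by rewrite inE /= two0 eqxx.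
by rewrite (pcharf_eq charK) inE => /eqP E; move: q_odd; rewrite -E.
Qed.
Let two_neq0 := odd_char_two_neq0.

Let q_gt0 : (0 < q)%N. Proof. exact: odd_gt0. Qed.

Lemma addchar_mulrn t n : psi (t *+ n) = psi t ^+ n.
Proof.
by case: psiP => p0 pD _; elim: n => [|n IH]; rewrite ?mulr0n // mulrS exprS pD IH.
Qed.

(** Frobenius raises the values of c to the power q and multiplies the argument
    of the additive character by q. *)
Lemma gauss_frob (c : F -> K) : mulchar (fun t => c t ^+ q) ->
  gauss psi c ^+ q = (c q%:R ^+ q)^-1 * gauss psi (fun t => c t ^+ q).
Proof.
move=> cq; rewrite -(gauss_scale psi cq q_neq0).
rewrite -(pFrobenius_autE charK) rmorph_sum; apply: eq_bigr => t _ /=.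
by rewrite pFrobenius_autE exprMn -addchar_mulrn mulr_natl.
Qed.

(** The quadratic Gauss sum is a square root of #|F|, on which Frobenius acts by
    the quadratic character of F at q: this is quadratic reciprocity. *)
Lemma card_expr_half : #|F|%:R ^+ (q./2) = (-1) ^+ qexp f q%:R :> K.
Proof.
have Q2 := qchar2_mulchar cardF f2 j2.
have E : (fun t => qchar2 f j t ^+ q) = qchar2 f j.
  apply: funext => t; have [->|t0] := eqVneq t 0.
    by rewrite /qchar2 /qchar eqxx mul0r expr0n (gtn_eqF q_gt0).
  by rewrite qchar2E // -exprM mulnC exprM -(signr_odd _ q) q_odd expr1.
have := @gauss_frob (qchar2 f j); rewrite E => /(_ Q2).
have -> : qchar2 f j q%:R ^+ q = qchar2 f j q%:R by rewrite -[in RHS]E.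
have g2 := gauss_qchar2_sqr cardF f2 j2 two_neq0 psiP.
have g0 : gauss psi (qchar2 f j) != 0.
  by move: card_neq0; rewrite -g2 sqrf_eq0.
rewrite qchar2E // -[in X in X = _](odd_double_half q) q_odd -mul2n exprD exprM.
rewrite g2 expr1 mulrC => /(mulIf g0) ->.
by rewrite -exprVn invrN1.
Qed.

Let pi_ : K := (primary_re f)%:~R + (primary_im f)%:~R * j.
Let pi_bar : K := (primary_re f)%:~R - (primary_im f)%:~R * j.

Lemma pi_norm : pi_ * pi_bar = #|F|%:R.
Proof. exact: (primary_norm_in cardF f2 j2 two_neq0 card_neq0 psiP). Qed.

Lemma frob_gaussian (a b : int) :
  (a%:~R + b%:~R * j) ^+ q = a%:~R + b%:~R * j ^+ q :> K.
Proof.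
rewrite -!(pFrobenius_autE charK) rmorphD rmorphM /= !rmorph_int //.
Qed.

(** In characteristic q, Frobenius multiplies the quartic Gauss sum g by 1 / chi(q)
    when q = 1 modulo 4, and sends it to chi(q) times its conjugate when
    q = 3 modulo 4. Comparison with g^4 = pi^3 pibar expresses chi(q) by pi
    and pibar; these are fixed by Frobenius in the first case and exchanged in
    the second. *)
Lemma qchar_signed_prime :
  qchar f j (signed_prime q)%:~R = conj_quot q pi_ pi_bar ^+ (quot_order q %/ 4).
Proof.
have Q := qchar_mulchar cardF f2 j2.
have Qn := qchar_mulchar cardF f2 (sqrtN1_opp j2).
have G4 := gauss_qchar_X4 cardF f2 j2 two_neq0 card_neq0 psiP.
have g0 := gauss_qchar_neq0 cardF f2 j2 two_neq0 card_neq0 psiP.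
have pn := pi_norm.
have : pi_ * pi_bar != 0 by rewrite pn.
rewrite mulf_eq0 negb_or => /andP[p0 pb0].
have X0 : qchar f j q%:R != 0 by apply: mulchar_neq0 Q _.
rewrite -/pi_ -pn in G4.
rewrite /signed_prime /quot_order /conj_quot; case: eqP => q4.
  have [k Eq] : exists k, q = (4 * k).+1.
    by exists (q %/ 4)%N; move: q4; clear; lia.
  have qX (z : K) : z ^+ q = (z ^+ 4) ^+ k * z by rewrite {1}Eq exprSr exprM.
  have jq : j ^+ q = j by rewrite -[RHS]expr1; apply: (jexp_mod j2).
  have E : (fun t => qchar f j t ^+ q) = qchar f j.
    apply: funext => t; have [->|t0] := eqVneq t 0.
      by rewrite /qchar eqxx expr0n (gtn_eqF q_gt0).
    by rewrite qcharE // exprAC jq.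
  have := @gauss_frob (qchar f j); rewrite E => /(_ Q).
  have -> : qchar f j q%:R ^+ q = qchar f j q%:R by rewrite -[in RHS]E.
  rewrite qX G4 => /(mulIf g0) X.
  have : pi_ ^+ q = pi_ by rewrite frob_gaussian jq.
  rewrite qX -[RHS]mul1r => /(mulIf p0) Y.
  have -> : (q.-1 %/ 4 = k)%N by rewrite Eq /= mulKn.
  rewrite -pmulrn -[LHS]invrK -X; apply: mulr1_eq; rewrite -exprMn -Y.
  by congr (_ ^+ _); field.
have [k Eq] : exists k, q = (4 * k).+3.
  exists (q %/ 4)%N; have := odd_mod q (erefl : odd 4 = false).
  rewrite q_odd {2}(divn_eq q 4); have := ltn_pmod q (isT : (0 < 4)%N).
  by move: q4; case: (q %% 4)%N => [|[|[|[|r]]]] //; clear; lia.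
have qX (z : K) : z ^+ q = (z ^+ 4) ^+ k * z ^+ 3.
  by rewrite {1}Eq -addn3 exprD exprM.
have jq : j ^+ q = - j.
  by rewrite -(sqrtN1_X3 j2); apply: (jexp_mod j2); rewrite Eq -addn3 mulnC modnMDl.
have E : (fun t => qchar f j t ^+ q) = qchar f (- j).
  apply: funext => t; have [->|t0] := eqVneq t 0.
    by rewrite /qchar eqxx expr0n (gtn_eqF q_gt0).
  by rewrite !qcharE // exprAC jq.
have := @gauss_frob (qchar f j); rewrite E => /(_ Qn).
have -> : qchar f j q%:R ^+ q = qchar f (- j) q%:R by rewrite -[in RHS]E.
have -> : (qchar f (- j) q%:R)^-1 = qchar f j q%:R.
  by apply: mulr1_eq; rewrite mulrC; apply: qcharNK.
move/(congr1 (fun z => gauss psi (qchar f j) * z)).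
rewrite -exprS {1}Eq -[(4 * k).+4]addn4 exprD exprM.
rewrite [gauss _ _ * (_ * _)]mulrCA.
rewrite (gauss_qchar_conj cardF f2 j2 two_neq0 psiP) -pn -exprSr G4.
have : pi_ ^+ q = pi_bar by rewrite frob_gaussian jq mulrN.
rewrite qX => Y X.
have -> : (q.+1 %/ 4 = k.+1)%N by rewrite Eq -[(4 * k).+4]addn4 -mulnSr mulKn.
have -> : qchar f j (- q%:Z)%:~R = qchar f j q%:R * qchar f j (-1).
  by case: Q => _ _ <-; rewrite mulrN1 rmorphN /= -pmulrn.
apply: (mulIf (mulf_neq0 p0 pb0)); rewrite -[LHS]mulrA -X.
have -> : pi_ ^+ 2 * (pi_ * pi_bar) = pi_ ^+ 4 * (pi_bar / pi_) by field.
by rewrite exprMn (exprS (pi_ ^+ 4)) -[X in _ = _ * (_ * X)]Y; ring.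
Qed.

End Frobenius.

Section ClosedField.
Variables (K : closedFieldType).

Lemma closed_root_monic (P : {poly K}) : (1 < size P)%N -> exists z, root P z.
Proof. by move=> sP; apply/closed_rootP; rewrite neq_ltn sP orbT. Qed.

Lemma exists_sqrtN1 : exists j : K, j ^+ 2 = -1.
Proof.
have [|z] := @closed_root_monic ('X^2 + 1); last first.
  by rewrite rootE !hornerE addr_eq0 => /eqP; exists z.
by rewrite (size_XnaddC 1).
Qed.

(** A root of 1 + X + ... + X^(p - 1) is a primitive p-th root of unity. *)
Lemma exists_addchar (p : nat) : prime p -> p%:R != 0 :> K ->
  exists psi : 'F_p -> K, addchar psi.
Proof.
move=> p_pr p0; have Np := Fp_cast p_pr; set N := (Zp_trunc (pdiv p)).+2 in Np.
have p1 := prime_gt1 p_pr.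
have [|z] := @closed_root_monic (\poly_(i < N) 1).
  by rewrite size_poly_eq ?oner_neq0 // Np.
rewrite rootE horner_poly; under eq_bigr do rewrite mul1r.
move/eqP => zS; have zN : z ^+ N = 1.
  by apply/eqP; rewrite -subr_eq0 subrX1 zS mulr0.
exists (fun t : 'F_p => z ^+ (t : nat)); split => //.
by move=> s t; rewrite /= -exprD; apply: expr_mod.
Qed.

End ClosedField.

(** * Primes of the form m^2 + x^2 *)

(** The square root of -1 modulo p = m^2 + x^2 for which x + m i lies in the
    kernel of the reduction sending i to it. *)
Definition qroot (p : nat) (m : int) (x : nat) : 'F_p := m%:~R / x%:R.

Section SumOfSquares.
Variables (p : nat) (m : int) (x : nat).
Hypothesis p_pr : prime p.
Hypothesis p_sum : p%:Z = m ^+ 2 + x%:Z ^+ 2.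
Hypothesis m_even : (2 %| m)%Z.
Hypothesis x_odd : odd x.
Local Notation f := (qroot p m x).

Lemma Fp_intr_eq0 (n : int) : (n%:~R == 0 :> 'F_p) = (p%:Z %| n)%Z.
Proof. by rewrite -(dvdz_pcharf (pchar_Fp p_pr)). Qed.

Lemma sum_squares_mod4 : (p %% 4 = 1)%N.
Proof.
have [k mk] := dvdzP m_even.
have xk : x = (2 * x./2).+1 by have := odd_double_half x; rewrite x_odd; lia.
have : p%:Z = 4 * (k ^+ 2 + x./2%:Z ^+ 2 + x./2%:Z) + 1.
  by rewrite p_sum mk {1}xk; lia.
lia.
Qed.

Lemma x_Fp_neq0 : x%:R != 0 :> 'F_p.
Proof.
rewrite -(dvdn_pcharf (pchar_Fp p_pr)); apply/negP => /dvdnP[k xk].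
have k0 : k != 0%N by apply/eqP => k0; move: x_odd; rewrite xk k0.
have p1 := prime_gt1 p_pr.
have : (p < x ^ 2)%N.
  apply: (@leq_trans (p ^ 2)).
    by rewrite -mulnn -[X in (X < _)%N]muln1 ltn_pmul2l ?prime_gt0.
  by rewrite xk leq_exp2r // leq_pmull // lt0n.
rewrite ltnNge -lez_nat p_sum => /negP; apply.
by rewrite -mulnn PoszM -expr2 lerDr sqr_ge0.
Qed.

Lemma qroot_mul_x : f * x%:R = m%:~R.
Proof. by rewrite divfK ?x_Fp_neq0. Qed.

Lemma qroot_sqr : f ^+ 2 = -1.
Proof.
have x0 := x_Fp_neq0.
apply: (mulIf (expf_neq0 2 x0)); rewrite -exprMn qroot_mul_x mulN1r.
apply/eqP; rewrite -addr_eq0; apply/eqP.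
have := congr1 (fun z : int => z%:~R : 'F_p) p_sum.
by rewrite -pmulrn pchar_Fp_0 // rmorphD !rmorphXn /= -pmulrn => <-.
Qed.

Lemma card_Fp_mod4 : (#|'F_p| %% 4 = 1)%N.
Proof. by rewrite card_Fp // sum_squares_mod4. Qed.

(** The Jacobi sum and x + m i have the same norm and are both killed by the
    reduction sending i to [qroot], so they generate the same prime ideal; the
    parity of the imaginary parts leaves only a sign. *)
Lemma primary_sign : exists eps : int, [/\ (eps == 1) || (eps == -1),
  primary_re f = eps * x%:Z, primary_im f = eps * m & exists k, eps * x%:Z + m = 1 + 4 * k].
Proof.
have c4 := card_Fp_mod4; have f2 := qroot_sqr.
have pC : p%:R != 0 :> algC by rewrite pnatr_eq0 -lt0n prime_gt0.
have [psi psiP] := exists_addchar p_pr pC.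
have := primary_norm c4 f2 psiP; rewrite card_Fp //.
have := primary_root c4 f2; have [k1 ak] := primary_mod4 c4 f2.
have [k2 bk] := primary_im_even c4 f2.
move: (primary_re f) (primary_im f) ak bk => a b ak bk root_ab norm_ab.
have : (p%:Z %| a * x%:Z + b * m)%Z.
  rewrite -Fp_intr_eq0 rmorphD !rmorphM /= -qroot_mul_x -pmulrn mulrA -mulrDl.
  by rewrite root_ab mul0r.
case/dvdzP => k kE.
have p0 : 0 < p%:Z by rewrite ltz_nat prime_gt0.
(* The product of a + b i and x - m i has norm p^2 and real part k p. *)
have id2 : (a * x%:Z + b * m) ^+ 2 + (a * m - b * x%:Z) ^+ 2 = p%:Z ^+ 2.
  have -> : p%:Z ^+ 2 = (a ^+ 2 + b ^+ 2) * (m ^+ 2 + x%:Z ^+ 2).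
    by rewrite -p_sum norm_ab expr2.
  by ring.
have [l ml] := dvdzP m_even.
have xk : x%:Z = 2 * x./2%:Z + 1 by have := odd_double_half x; rewrite x_odd; lia.
(* The real part a x + b m is odd, since a and x are odd and m is even. *)
have k0 : k != 0.
  apply/eqP => k0; move: kE; rewrite k0 mul0r bk xk ml => E; move: ak; rewrite bk => ak'.
  have : 2 * (2 * k1 * x./2%:Z * 2 + 2 * k1 - k2 * 2 * x./2%:Z - k2 + x./2%:Z + k2 * l * 2) = -1.
    have aE : a = 1 + 4 * k1 - 2 * k2 by lia.
    by rewrite -[RHS]add0r -E aE; ring.
  by move: (X in 2 * X = -1) => z; lia.
have k2le : k ^+ 2 <= 1.
  rewrite -(ler_pM2r (exprn_gt0 2 p0)) -exprMn -kE mul1r -id2.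
  by rewrite lerDl sqr_ge0.
have kpm := int_sqr_le1 k0 k2le.
have ksq : k ^+ 2 = 1 by case/orP: kpm => /eqP ->.
have amb : a * m - b * x%:Z = 0.
  apply/eqP; rewrite -sqrf_eq0; apply/eqP.
  by move: id2; rewrite kE exprMn ksq mul1r => /eqP; rewrite -subr_eq0 addrC addKr => /eqP.
have aE : a = k * x%:Z.
  apply: (@mulIf _ p%:Z); first by rewrite gt_eqF.
  have -> : k * x%:Z * p%:Z = x%:Z * (k * p%:Z) by ring.
  rewrite -kE {1}p_sum.
  have -> : a * (m ^+ 2 + x%:Z ^+ 2) = x%:Z * (a * x%:Z + b * m) + m * (a * m - b * x%:Z) by ring.
  by rewrite amb mulr0 addr0.
have bE : b = k * m.
  apply: (@mulIf _ p%:Z); first by rewrite gt_eqF.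
  have -> : k * m * p%:Z = m * (k * p%:Z) by ring.
  rewrite -kE {1}p_sum.
  have -> : b * (m ^+ 2 + x%:Z ^+ 2) = m * (a * x%:Z + b * m) - x%:Z * (a * m - b * x%:Z) by ring.
  by rewrite amb mulr0 subr0.
exists k; split=> //.
exists (k1 + (if k == 1 then 0 else l)).
move: ak; rewrite aE bE ml; move: kpm; clear.
by case/orP=> /eqP -> /= E; lia.
Qed.

End SumOfSquares.

(** * The trace of y^2 = x^3 + D x *)

Section CurvePoints.
Variables (F : finFieldType) (f : F).
Hypothesis cardF : (#|F| %% 4 = 1)%N.
Hypothesis f2 : f ^+ 2 = -1.
Local Notation e := (qexp f).

Definition nsqrt (c : F) : nat := #|[pred y : F | y ^+ 2 == c]|.

Lemma sum_sqr (V : nmodType) (G : F -> V) :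
  \sum_y G (y ^+ 2) = \sum_c G c *+ nsqrt c.
Proof.
rewrite (partition_big (fun y : F => y ^+ 2) predT) //=.
apply: eq_bigr => c _; rewrite (eq_bigr (fun=> G c)) => [|y /eqP -> //].
by rewrite sumr_const; congr (_ *+ _); apply: eq_card => y.
Qed.

Lemma nsqrt0 : nsqrt 0 = 1%N.
Proof.
rewrite /nsqrt (eq_card (B := pred1 (0 : F))) ?card1 // => y.
by rewrite !inE sqrf_eq0.
Qed.

Lemma nsqrt_le c : c != 0 -> (nsqrt c)%:Z <= 1 + (-1) ^+ e c.
Proof.
move=> c0; case: (pickP [pred y : F | y ^+ 2 == c]) => [y0 /= /eqP y0c|none].
  have y00 : y0 != 0 by rewrite -sqrf_eq0 y0c.
  have ec : ~~ odd (e c).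
    have /(congr1 odd) := qexpX cardF f2 2 y00.
    by rewrite y0c !odd_mod // oddM => ->.
  rewrite -signr_odd (negPf ec) lez_nat.
  rewrite (leq_trans (subset_leq_card _) (card_size [:: y0; - y0])) //.
  by apply/fintype.subsetP => y; rewrite !inE -y0c eqf_sqr.
rewrite /nsqrt eq_card0 => [|y]; last exact: none.
by rewrite -signr_odd; case: (odd _).
Qed.

(** One side is at most the other by [nsqrt_le], and they have the same sum over the
    nonzero c, namely the number of nonzero y. *)
Lemma nsqrtE_neq0 c : c != 0 -> (nsqrt c)%:Z = 1 + (-1) ^+ e c.
Proof.
move=> c0; apply/eqP; rewrite eq_sym -subr_eq0; apply/eqP.
apply: (psumr_eq0P (P := fun c => c != 0)
          (F := fun c => 1 + (-1) ^+ e c - (nsqrt c)%:Z)) c0 => [i i0|].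
  by rewrite subr_ge0 nsqrt_le.
rewrite sumrB big_split /= (sum_sign_qexp cardF f2) addr0 (sum_neq0_1 cardF).
have := @sum_sqr int (fun=> 1); rewrite (bigD1 0) //= [RHS](bigD1 0) //=.
rewrite nsqrt0 mulr1n => /addrI; rewrite (sum_neq0_1 cardF) => ->.
by rewrite -sumrB big1 // => i _; rewrite -natz subrr.
Qed.

Section Evaluate.
Variables (K : fieldType) (j : K).
Hypothesis j2 : j ^+ 2 = -1.
Hypothesis two_neq0 : 2 != 0 :> K.
Local Notation phi := (qchar2 f j).

Lemma nsqrtE c : (nsqrt c)%:R = 1 + phi c :> K.
Proof.
have [->|c0] := eqVneq c 0; first by rewrite nsqrt0 /qchar2 /qchar eqxx mul0r addr0.
by rewrite qchar2E // pmulrn nsqrtE_neq0 // rmorphD rmorphXn rmorphN1.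
Qed.

Lemma twisted_jacobi (c : F -> K) (D : F) : mulchar c -> D != 0 ->
  \sum_t c t * phi (t + D) = c (- D) * phi D * jacobi c phi.
Proof.
move=> [_ _ cM] D0; have [_ _ pM] := qchar2_mulchar cardF f2 j2.
rewrite (reindex_mulf (a := - D)) ?oppr_eq0 // mulr_sumr.
apply: eq_bigr => s _; rewrite cM.
have -> : - D * s + D = D * (1 - s) by ring.
by rewrite pM mulrACA.
Qed.

(** chi^2(x) = chi(x^2), so that x only enters through t = x^2. *)
Lemma sum_phi_cubic (D : F) : D != 0 ->
  \sum_x phi (x ^+ 3 + D * x) =
  qchar f j (- D) * phi D * jacobi (qchar f j) phi +
  qchar f (- j) (- D) * phi D * jacobi (qchar f (- j)) phi.
Proof.
move=> D0; have Q := qchar_mulchar cardF f2 j2.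
have Qn := qchar_mulchar cardF f2 (sqrtN1_opp j2).
have [_ _ pM] := qchar2_mulchar cardF f2 j2; case: (Q) => _ _ qM.
rewrite -!twisted_jacobi // -big_split /=.
transitivity (\sum_x qchar f j (x ^+ 2) * phi (x ^+ 2 + D)).
  apply: eq_bigr => x _.
  have -> : x ^+ 3 + D * x = x * (x ^+ 2 + D) by ring.
  by rewrite pM expr2 qM.
rewrite (sum_sqr (fun t => qchar f j t * phi (t + D))).
apply: eq_bigr => t _.
by rewrite -mulr_natr nsqrtE -(qchar_qchar2 f j2); ring.
Qed.

End Evaluate.

Lemma card_curve (D : F) :
  #|[pred P : F * F | P.2 ^+ 2 == P.1 ^+ 3 + D * P.1]| =
  (\sum_(x : F) nsqrt (x ^+ 3 + D * x)%R)%N.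
Proof.
rewrite -sum1_card (eq_bigl (fun P : F * F => P.2 ^+ 2 == P.1 ^+ 3 + D * P.1)) //.
rewrite -(pair_big_dep predT (fun x y => y ^+ 2 == x ^+ 3 + D * x) (fun _ _ => 1%N)).
by apply: eq_bigr => x _; rewrite sum1_card.
Qed.

(** With N(t) = 1 + chi^2(t) square roots of t, the sum of chi^2(x^3 + D x) becomes
    after t = x^2 the sum of (chi(t) + chibar(t)) chi^2(t + D), that is, two Jacobi
    sums. The right hand side is twice the real part of (a + b i) / chi(-D). *)
Lemma curve_trace (D : F) : D != 0 ->
  #|F|%:Z - #|[pred P : F * F | P.2 ^+ 2 == P.1 ^+ 3 + D * P.1]|%:Z =
  2 * (re4 (e (- D)) * primary_re f + im4 (e (- D)) * primary_im f).
Proof.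
move=> D0; pose j : algC := 'i; have i2 : j ^+ 2 = -1 by exact: sqrCi.
apply/eqP; rewrite -(eqr_int algC) card_curve; apply/eqP.
rewrite rmorphB /= -!pmulrn raddf_sum /=.
under eq_bigr do rewrite (nsqrtE i2).
rewrite big_split /= sumr_const (sum_phi_cubic i2) // jacobi_qchar //.
have E t : qchar2 f j t = qchar2 f (- j) t by rewrite qchar2_opp.
rewrite (funext E) jacobi_qchar ?sqrtN1_opp // -(funext E).
have -> : qchar2 f j D = (-1) ^+ e (- D).
  case: (qchar2_mulchar cardF f2 i2) => _ _ pM.
  by rewrite -{1}[D]opprK -{1}[- - D]mulN1r pM qchar2N1 // mul1r qchar2E ?oppr_eq0.
rewrite !qcharE ?oppr_eq0 // -!exprMn !mulrN1 opprK.
rewrite (expr_re4im4 i2) (expr_re4im4 (sqrtN1_opp i2)).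
rewrite -[#|xpredT|]/(#|F|) opprD addrA subrr add0r.
by ring: i2.
Qed.

End CurvePoints.

(** * The quartic character of 2 *)

Lemma exists_closed_pchar (l : nat) : prime l ->
  exists K : closedFieldType, l \in [pchar K].
Proof.
move=> l_pr; have [K [FtoK _]] := countable_algebraic_closure 'F_l.
by exists K; apply: (rmorph_pchar FtoK); apply: pchar_Fp.
Qed.

Section PrimeField.
Variables (l : nat) (K : closedFieldType).
Hypothesis charK : l \in [pchar K].
Hypothesis l_odd : odd l.

Lemma fermat_int (n : int) : n%:~R != 0 :> K -> (n%:~R : K) ^+ l.-1 = 1.
Proof.
move=> n0; apply: (mulIf n0); rewrite mul1r -exprSr prednK ?odd_gt0 //.
by rewrite -(pFrobenius_autE charK) rmorph_int.
Qed.

Lemma half_double : l.-1 = (2 * l./2)%N.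
Proof. by rewrite -[in LHS](odd_double_half l) l_odd mul2n. Qed.

Lemma euler_int_sqr (n : int) : n%:~R != 0 :> K -> (n%:~R ^+ 2 : K) ^+ l./2 = 1.
Proof. by move=> n0; rewrite -exprM -half_double fermat_int. Qed.

(** sqrt 2 = w + 1 / w for w a primitive eighth root of unity, and raising to the
    power l permutes these roots. *)
Lemma two_expr_half : 2 ^+ l./2 = (-1) ^+ two_char l :> K.
Proof.
have two0 := odd_char_two_neq0 charK l_odd.
have [j j2] := exists_sqrtN1 K.
have [w w2] : exists w : K, w ^+ 2 = j.
  have [|w] := @closed_root_monic K ('X^2 - j%:P); last first.
    by rewrite rootE !hornerE subr_eq0 => /eqP; exists w.
  by rewrite size_XnsubC.
have w4 : w ^+ 4 = -1 by rewrite (exprM _ 2 2) w2.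
have w8 : w ^+ 8 = 1 by rewrite (exprM _ 4 2) w4 sqrrN expr1n.
pose t := w + w ^+ 7.
have t2 : t ^+ 2 = 2.
  have -> : t ^+ 2 = w ^+ 2 + 2 * w ^+ 8 + w ^+ 8 * w ^+ 4 * w ^+ 2 by rewrite /t; ring.
  by rewrite w8 w4; ring.
have t0 : t != 0 by rewrite -sqrf_eq0 t2.
apply: (mulIf t0).
have -> : 2 ^+ l./2 * t = t ^+ l.
  by rewrite -t2 -exprM -half_double -exprSr prednK // odd_gt0.
rewrite -(pFrobenius_autE charK) rmorphD rmorphXn /= !pFrobenius_autE.
have -> : (w ^+ l) = w ^+ (l %% 8) by rewrite expr_mod.
have := odd_mod l (erefl : odd 8 = false); rewrite l_odd /two_char.
have := ltn_pmod l (isT : (0 < 8)%N); move: (l %% 8)%N => r.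
case: r => [|[|[|[|[|[|[|[|]]]]]]]] // _ _; rewrite /= /t ?expr0 ?expr1.
- by ring.
- have -> : (w ^+ 3) ^+ 7 = w ^+ 8 * w ^+ 8 * w ^+ 4 * w by ring.
  have -> : w ^+ 7 = w ^+ 4 * w ^+ 3 by ring.
  by rewrite w8 w4; ring.
- have -> : (w ^+ 5) ^+ 7 = w ^+ 8 * w ^+ 8 * w ^+ 8 * w ^+ 8 * w ^+ 3 by ring.
  have -> : w ^+ 7 = w ^+ 4 * w ^+ 3 by ring.
  have -> : w ^+ 5 = w ^+ 4 * w by ring.
  by rewrite w8 w4; ring.
have -> : (w ^+ 7) ^+ 7 = (w ^+ 8) ^+ 6 * w by ring.
by rewrite w8 expr1n; ring.
Qed.

End PrimeField.

Section SupplementTwo.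
Variables (p : nat) (m : int) (x : nat).
Hypothesis p_pr : prime p.
Hypothesis p_sum : p%:Z = m ^+ 2 + x%:Z ^+ 2.
Hypothesis m_even : (2 %| m)%Z.
Hypothesis x_odd : odd x.
Local Notation f := (qroot p m x).
Local Notation s := (absz (x%:Z + m)%R).
Let c4 := card_Fp_mod4 p_pr p_sum m_even x_odd.
Let f2 := qroot_sqr p_pr p_sum x_odd.

Lemma euler_criterion (l : nat) (K : closedFieldType) :
  l \in [pchar K] -> odd l -> l != p ->
  p%:R ^+ l./2 = (-1) ^+ qexp f l%:R :> K.
Proof.
move=> lK l_odd lp; have l_pr := pcharf_prime lK.
have pK : p%:R != 0 :> K.
  by rewrite -(dvdn_pcharf lK) dvdn_prime2.
have [psi psiP] := exists_addchar p_pr pK.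
have [j j2] := exists_sqrtN1 K.
have := card_expr_half c4 f2 j2 lK l_odd _ _ psiP.
rewrite card_Fp //; apply=> //.
by rewrite -(dvdn_pcharf (pchar_Fp p_pr)) dvdn_prime2 // eq_sym.
Qed.

Lemma dvd_x_neq (l : nat) : prime l -> (l %| x)%N -> l != p.
Proof.
move=> l_pr lx; apply: contra (x_Fp_neq0 p_pr p_sum x_odd) => /eqP <-.
by rewrite -(dvdn_pcharf (pchar_Fp l_pr)).
Qed.

(** Modulo a prime factor l of x, p = m^2 is a square, hence so is l modulo p. *)
Lemma qexp_dvd_x (l : nat) : prime l -> (l %| x)%N -> ~~ odd (qexp f l%:R).
Proof.
move=> l_pr lx; have lp := dvd_x_neq l_pr lx.
have l_odd : odd l by apply: dvdn_odd lx x_odd.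
have [K lK] := exists_closed_pchar l_pr.
have xK : x%:R = 0 :> K by apply/eqP; rewrite -(dvdn_pcharf lK).
have pE : p%:R = m%:~R ^+ 2 :> K.
  have := congr1 (fun z : int => z%:~R : K) p_sum.
  by rewrite -pmulrn rmorphD !rmorphXn /= -pmulrn xK expr0n addr0.
have pK : p%:R != 0 :> K by rewrite -(dvdn_pcharf lK) dvdn_prime2.
have := euler_criterion lK l_odd lp; rewrite pE euler_int_sqr //; last first.
  by rewrite -sqrf_eq0 -pE.
rewrite -signr_odd; case: (odd _) => // /eqP.
by rewrite eq_sym expr1 (negPf (N1_neq1 (odd_char_two_neq0 lK l_odd))).
Qed.

Lemma x_add_m_odd : odd s.
Proof.
have [k ->] := dvdzP m_even; have := odd_double_half x; rewrite x_odd => xk.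
lia.
Qed.

Lemma x_add_m_neq0 : (x%:Z + m)%:~R != 0 :> 'F_p.
Proof.
apply/eqP; rewrite rmorphD /= -pmulrn -(qroot_mul_x p_pr p_sum x_odd) // => E.
have : (1 + f) * x%:R = 0 by rewrite mulrDl mul1r.
move/eqP; rewrite mulf_eq0 (negPf (x_Fp_neq0 p_pr p_sum x_odd)) orbF addrC addr_eq0.
move/eqP=> fE; have := f2; rewrite fE sqrrN expr1n => /esym/eqP.
by apply/negP/N1_neq1/(F_two_neq0 c4).
Qed.

(** As 2 p = (x + m)^2 + (x - m)^2, 2 p is a square modulo l, hence
    (l / p) = (p / l) = (2 / l). *)
Lemma qexp_dvd_x_add_m (l : nat) : prime l -> (l %| s)%N ->
  odd (qexp f l%:R) = two_char l.
Proof.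
move=> l_pr lx.
have lp : l != p.
  apply: contra x_add_m_neq0 => /eqP <-.
  by rewrite -(dvdz_pcharf (pchar_Fp l_pr)).
have l_odd : odd l by apply: dvdn_odd lx x_add_m_odd.
have [K lK] := exists_closed_pchar l_pr.
have two0 := odd_char_two_neq0 lK l_odd.
have xK : (x%:Z + m)%:~R = 0 :> K by apply/eqP; rewrite -(dvdz_pcharf lK).
have pE : 2 * p%:R = (x%:Z - m)%:~R ^+ 2 :> K.
  have := congr1 (fun z : int => z%:~R : K) p_sum.
  rewrite -pmulrn rmorphD !rmorphXn /= -pmulrn => ->.
  move: xK; rewrite rmorphD rmorphB /= -pmulrn => xK.
  move: xK; move: (x%:R : K) (m%:~R : K) => X M XM0.
  have -> : X = - M by apply/eqP; rewrite -addr_eq0 XM0.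
  by ring.
have pK : p%:R != 0 :> K by rewrite -(dvdn_pcharf lK) dvdn_prime2.
have := euler_int_sqr lK l_odd (n := x%:Z - m); rewrite -sqrf_eq0 -pE.
rewrite mulf_neq0 // exprMn two_expr_half // (euler_criterion lK) // => /(_ isT).
rewrite -[(-1) ^+ qexp _ _]signr_odd.
have := N1_neq1 two0.
case: (odd _); case: (two_char l); rewrite //= ?expr1 ?expr0 ?mulr1 ?mul1r => /eqP h1 h2 //.
Qed.

Lemma qexp_x : ~~ odd (qexp f x%:R).
Proof.
suff : forall n, (0 < n)%N -> (n %| x)%N -> ~~ odd (qexp f n%:R).
  by apply; rewrite ?dvdnn ?odd_gt0.
apply: prime_mul_ind => [_|l n l_pr n0 IH lnx].
  by rewrite (odd_eqmod4 (qexp1 c4 f2)).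
have lx : (l %| x)%N by apply: dvdn_trans lnx; apply: dvdn_mulr.
have nx : (n %| x)%N by apply: dvdn_trans lnx; apply: dvdn_mull.
have unit_dvd k : (k %| x)%N -> k%:R != 0 :> 'F_p.
  move=> /dvdnP[r xr]; apply: contra (x_Fp_neq0 p_pr p_sum x_odd).
  by rewrite xr natrM => /eqP ->; rewrite mulr0.
rewrite natrM (odd_eqmod4 (qexpM c4 f2 (unit_dvd _ lx) (unit_dvd _ nx))) oddD.
have even_add a b : ~~ a -> ~~ b -> ~~ (a (+) b) by case: a; case: b.
exact: (even_add _ _ (qexp_dvd_x l_pr lx) (IH nx)).
Qed.

Lemma qexp_x_add_m : odd (qexp f (x%:Z + m)%:~R) = two_char s.
Proof.
have unit_dvd k : (k %| s)%N -> k%:R != 0 :> 'F_p.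
  move=> kx; apply: contra x_add_m_neq0; rewrite -(dvdn_pcharf (pchar_Fp p_pr)) => pk.
  rewrite -(dvdz_pcharf (pchar_Fp p_pr)); exact: dvdn_trans kx.
have H : forall n, (0 < n)%N -> (n %| s)%N ->
    odd (qexp f n%:R) = two_char n.
  apply: prime_mul_ind => [_|l n l_pr n0 IH lnx].
    by rewrite (odd_eqmod4 (qexp1 c4 f2)).
  have lx : (l %| s)%N by apply: dvdn_trans lnx; apply: dvdn_mulr.
  have nx : (n %| s)%N by apply: dvdn_trans lnx; apply: dvdn_mull.
  rewrite natrM (odd_eqmod4 (qexpM c4 f2 (unit_dvd _ lx) (unit_dvd _ nx))) oddD.
  have l_odd := dvdn_odd lx x_add_m_odd; have n_odd := dvdn_odd nx x_add_m_odd.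
  rewrite (two_charM l_odd n_odd); congr (_ (+) _); last exact: IH.
  exact: qexp_dvd_x_add_m.
rewrite -(H _ (odd_gt0 x_add_m_odd) (dvdnn _)).
have [s0|s0] := lerP 0 (x%:Z + m); first by rewrite -{1}(gez0_abs s0).
rewrite -[in LHS](opprK (x%:Z + m)) -(ltz0_abs s0) rmorphN /= -pmulrn.
exact: (odd_qexpN c4 f2 (unit_dvd _ (dvdnn _))).
Qed.

(** As (x + m)^2 = 2 x m modulo p, the quartic character of 2 x m is the quadratic
    character of x + m, that is (2 / |x + m|). Taking out the factors x, a square,
    and m / x, the chosen square root of -1, leaves (2 / pi)_4 = i^(x m / 2). *)
Lemma qexp_two (h : int) : m = h * 2 -> (4 %| (qexp f 2%R)%:Z - x%:Z * h)%Z.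
Proof.
move=> mh; have x0 := x_Fp_neq0 p_pr p_sum x_odd.
have two0 := F_two_neq0 c4; have f0 := f_neq0 f2.
set n4 := (#|'F_p|.-1 %/ 4)%N.
have pn4 : p = (4 * n4).+1 by rewrite -[LHS](card_Fp p_pr) (card_n4 c4).
have sqrE : (x%:Z + m)%:~R ^+ 2 = 2 * (x%:R ^+ 2 * f) :> 'F_p.
  have := congr1 (fun z : int => z%:~R : 'F_p) p_sum.
  rewrite -pmulrn pchar_Fp_0 // !rmorphD !rmorphXn /= -!pmulrn.
  rewrite -(qroot_mul_x p_pr p_sum x_odd); move: (x%:R : 'F_p) => X E.
  by apply/eqP; rewrite -subr_eq0 [X in _ == X]E; apply/eqP; ring.
have E1 := qexpX c4 f2 2 x_add_m_neq0.
have xf0 : x%:R ^+ 2 * f != 0 by rewrite mulf_neq0 // expf_neq0.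
have E2 := qexpM c4 f2 two0 xf0.
have E3 := qexpM c4 f2 (expf_neq0 2 x0) f0.
have E4 := qexpX c4 f2 2 x0.
have E5 : qexp f f = n4 %[mod 4] by apply: qexp_eq.
have [k sk] := sqr_mod16 x_add_m_odd.
have s2 : (s ^ 2)%N%:Z = 4 * (n4%:Z + x%:Z * h) + 1.
  rewrite -mulnn PoszM -expr2 abszE -normrX ger0_norm ?sqr_ge0 //.
  have -> : (x%:Z + m) ^+ 2 = p%:Z + 2 * (x%:Z * m) by rewrite p_sum; ring.
  have pz : p%:Z = 4 * n4%:Z + 1 by rewrite [in LHS]pn4 -addn1 PoszD PoszM.
  by rewrite pz mh; ring.
have ox := qexp_x; have os := qexp_x_add_m.
rewrite sqrE in E1.
move: (x%:Z * h) s2 sk os ox E1 E2 E3 E4 E5.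
move: (s ^ 2)%N (two_char _) (qexp f (2 * (x%:R ^+ 2 * f))) (qexp f (x%:Z + m)%:~R).
move: (qexp f (x%:R ^+ 2 * f)) (qexp f x%:R) (qexp f f) (qexp f (x%:R ^+ 2)) (qexp f 2).
move: (n4); clear; move=> n4 a b c d e s2 tc g h xh.
by case: tc; lia.
Qed.

End SupplementTwo.

(** * Values of the reciprocity symbol modulo q *)

Section QuotientModQ.
Variables (q : nat) (m : int) (K : closedFieldType) (j : K).
Hypothesis q_odd : odd q.
Hypothesis charK : q \in [pchar K].
Hypothesis j2 : j ^+ 2 = -1.
Let q_pr := pcharf_prime charK.
Let two_neq0 := odd_char_two_neq0 charK q_odd.

Definition gint (y : nat) : K := y%:R + m%:~R * j.
Definition gconj (y : nat) : K := y%:R - m%:~R * j.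
Definition unit_mod (y : nat) : bool := ~~ (q%:Z %| y%:Z ^+ 2 + m ^+ 2)%Z.
Definition qquot (y : nat) : K := conj_quot q (gint y) (gconj y).
(** The quartic residue symbol, as an exponent, of the residue y of x; it is
    meaningful when [unit_mod y], that is, when q does not divide y^2 + m^2. *)
Definition quot_exp (y : nat) : nat := log4 j (qquot y ^+ (quot_order q %/ 4)).

Lemma gint_norm y : gint y * gconj y = (y%:Z ^+ 2 + m ^+ 2)%:~R.
Proof.
by rewrite mulrC -subr_sqr exprMn j2 mulrN1 opprK rmorphD !rmorphXn.
Qed.

Lemma unit_modE y : unit_mod y = (gint y != 0) && (gconj y != 0).
Proof. by rewrite /unit_mod (dvdz_pcharf charK) -gint_norm mulf_eq0 negb_or. Qed.

Lemma qmod4_not1 : (q %% 4)%N <> 1%N -> (q %% 4 = 3)%N.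
Proof.
have := odd_mod q (erefl : odd 4 = false); rewrite q_odd.
by have := ltn_pmod q (isT : (0 < 4)%N); case: (q %% 4)%N => [|[|[|[|r]]]].
Qed.

Lemma quot_order_dvd4 : (4 %| quot_order q)%N.
Proof.
rewrite /quot_order; have qE := divn_eq q 4.
case: eqP => [q4|/qmod4_not1 q4]; rewrite q4 in qE; rewrite qE.
  by rewrite addn1 dvdn_mull.
by rewrite -addnS dvdn_add // dvdn_mull.
Qed.

Lemma quot_orderE : quot_order q = (4 * (quot_order q %/ 4))%N.
Proof. by rewrite mulnC divnK // quot_order_dvd4. Qed.

Lemma gint_frob1 y : (q %% 4 = 1)%N -> gint y ^+ q = gint y /\ gconj y ^+ q = gconj y.
Proof.
move=> q4; have jq : j ^+ q = j by rewrite -[RHS]expr1; apply: (jexp_mod j2); rewrite q4.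
have := frob_gaussian j charK y%:Z m; have := frob_gaussian j charK y%:Z (- m).
by rewrite jq !rmorphN /= -!pmulrn !mulNr.
Qed.

Lemma gint_frob3 y : (q %% 4 = 3)%N -> gint y ^+ q = gconj y /\ gconj y ^+ q = gint y.
Proof.
move=> q4; have jq : j ^+ q = - j.
  by rewrite -(sqrtN1_X3 j2); apply: (jexp_mod j2); rewrite q4.
have := frob_gaussian j charK y%:Z m; have := frob_gaussian j charK y%:Z (- m).
by rewrite jq !rmorphN /= -!pmulrn !mulNr !mulrN opprK.
Qed.

Lemma qquot_order y : unit_mod y -> qquot y ^+ quot_order q = 1.
Proof.
rewrite unit_modE => /andP[g0 gc0]; have q_gt0 := odd_gt0 q_odd.
have quot0 : qquot y != 0.
  by rewrite /qquot /conj_quot; case: ifP => _; rewrite mulf_neq0 ?invr_eq0.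
rewrite /quot_order; case: eqP => [q4|/qmod4_not1 q4].
  apply: (mulIf quot0); rewrite mul1r -exprSr prednK //.
  have [E1 E2] := gint_frob1 y q4.
  by rewrite /qquot /conj_quot q4 /= exprMn exprVn E1 E2.
rewrite exprSr; have [E1 E2] := gint_frob3 y q4.
rewrite /qquot /conj_quot q4 /= exprMn exprVn E1 E2.
by field; rewrite g0 gc0.
Qed.

Lemma quot_expP y : unit_mod y ->
  qquot y ^+ (quot_order q %/ 4) = j ^+ quot_exp y.
Proof.
move=> uy; apply: (log4P j2 two_neq0).
by rewrite -exprM divnK ?quot_order_dvd4 // qquot_order.
Qed.

Lemma quot_exp_period y z : y = z %[mod q] -> quot_exp y = quot_exp z.
Proof.
move=> yz; suff E : y%:R = z%:R :> K by rewrite /quot_exp /qquot /gint /gconj E.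
have natq n : (n %% q)%:R = n%:R :> K.
  by rewrite [in RHS](divn_eq n q) natrD natrM (pcharf0 charK) mulr0 add0r.
by rewrite -natq yz natq.
Qed.

Lemma quot_exp_dvd y : (q%:Z %| m)%Z -> unit_mod y -> quot_exp y = 0 %[mod 4].
Proof.
move=> qm uy; apply/eqP; rewrite -(eq_sqrtN1_expr j2 two_neq0) -quot_expP //.
have m0 : m%:~R = 0 :> K by apply/eqP; rewrite -(dvdz_pcharf charK).
move: uy; rewrite unit_modE /qquot /conj_quot /gint /gconj m0 mul0r addr0 subr0.
by case/andP=> y0 _; rewrite if_same divff // expr1n.
Qed.

(** The sign between the primary prime and x + m i disappears in the quotient by the
    conjugate. *)
Lemma quot_exp_reciprocity (p x : nat) : prime p ->
  p%:Z = m ^+ 2 + x%:Z ^+ 2 -> (2 %| m)%Z -> odd x -> q != p ->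
  qexp (qroot p m x) (signed_prime q)%:~R = quot_exp x %[mod 4].
Proof.
move=> p_pr p_sum m_even x_odd qp.
have c4 := card_Fp_mod4 p_pr p_sum m_even x_odd.
have f2 := qroot_sqr p_pr p_sum x_odd.
have pK : p%:R != 0 :> K by rewrite -(dvdn_pcharf charK) dvdn_prime2.
have qF : q%:R != 0 :> 'F_p.
  by rewrite -(dvdn_pcharf (pchar_Fp p_pr)) dvdn_prime2 // eq_sym.
have [psi psiP] := exists_addchar p_pr pK.
have cK : #|'F_p|%:R != 0 :> K by rewrite card_Fp.
have ux : unit_mod x.
  by rewrite /unit_mod addrC -p_sum; move: qp; rewrite -dvdn_prime2.
have := qchar_signed_prime c4 f2 j2 charK q_odd cK qF psiP.
have [eps [epsP -> -> _]] := primary_sign p_pr p_sum m_even x_odd.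
have sF : (signed_prime q)%:~R != 0 :> 'F_p.
  by rewrite /signed_prime; case: ifP => _; rewrite ?rmorphN ?oppr_eq0 /= -pmulrn.
rewrite qcharE // => E; apply/eqP; rewrite -(eq_sqrtN1_expr j2 two_neq0) E -quot_expP //.
apply/eqP; congr (_ ^+ _).
rewrite /qquot /conj_quot !rmorphM /= -!pmulrn -!mulrA -mulrDr -mulrBr.
have e0 : eps%:~R != 0 :> K.
  by case/orP: epsP => /eqP ->; rewrite ?rmorphN ?oppr_eq0 oner_neq0.
by case: ifP => _; rewrite invfM mulrACA divff // mul1r.
Qed.

Section Distribution.
Hypothesis qm : ~~ (q%:Z %| m)%Z.

Let m_neq0 : m%:~R != 0 :> K. Proof. by rewrite -(dvdz_pcharf charK). Qed.
Let j_neq0 := sqrtN1_neq0 j2.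

Lemma gint_neq_gconj y : gint y != gconj y.
Proof.
rewrite -subr_eq0; have -> : gint y - gconj y = 2 * m%:~R * j.
  by rewrite /gint /gconj; ring.
by rewrite !mulf_eq0 (negPf two_neq0) (negPf m_neq0) (negPf j_neq0).
Qed.

Lemma natr_inj_mod y z : (y < q)%N -> (z < q)%N -> y%:R = z%:R :> K -> y = z.
Proof.
wlog yz : y z / (y <= z)%N.
  by move=> H yq zq E; case: (leqP y z) => [|/ltnW] h; [apply: H|symmetry; apply: H].
move=> yq zq /esym/eqP; rewrite -subr_eq0 -natrB // -(dvdn_pcharf charK) => d.
case: (posnP (z - y)%N) => [/eqP|d0].
  by rewrite subn_eq0 => zy; apply/eqP; rewrite eqn_leq yz.
by have := dvdn_leq d0 d; rewrite leqNgt (leq_ltn_trans (leq_subr _ _) zq).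
Qed.

Lemma qquot_neq1 y : unit_mod y -> qquot y != 1.
Proof.
rewrite unit_modE => /andP[g0 gc0].
have /eqP H := gint_neq_gconj y.
apply/eqP; rewrite /qquot /conj_quot; case: ifP => _.
  by move/(canRL (divfK gc0)); rewrite mul1r.
by move/(canRL (divfK g0)); rewrite mul1r => /esym.
Qed.

Lemma qquot_inj y z : (y < q)%N -> (z < q)%N -> unit_mod y -> unit_mod z ->
  qquot y = qquot z -> y = z.
Proof.
move=> yq zq; rewrite !unit_modE => /andP[gy gcy] /andP[gz gcz] E.
apply: natr_inj_mod => //.
have {}E : gint y * gconj z = gint z * gconj y.
  move: E; rewrite /qquot /conj_quot; case: ifP => _ /eqP; rewrite eqr_div // => /eqP // E.
  by rewrite mulrC -E mulrC.
apply/eqP; rewrite -subr_eq0.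
have : 2 * m%:~R * j * (y%:R - z%:R) = 0.
  have -> : 2 * m%:~R * j * (y%:R - z%:R) = gint z * gconj y - gint y * gconj z.
    by rewrite /gint /gconj; ring.
  by rewrite E subrr.
by move/eqP; rewrite !mulf_eq0 (negPf two_neq0) (negPf m_neq0) (negPf j_neq0).
Qed.

Local Notation n4 := (quot_order q %/ 4)%N.

Lemma quot_order_gt0 : prime q -> (0 < n4)%N.
Proof.
move=> q_prime; rewrite divn_gt0 // dvdn_leq ?quot_order_dvd4 // /quot_order.
by case: ifP => // _; rewrite -subn1 subn_gt0 prime_gt1.
Qed.

Definition quot_class (i : nat) : pred nat :=
  fun y => unit_mod y && (quot_exp y == i %[mod 4]).

(** The residues of a class give distinct roots of X^(n / 4) - j^i, and 1 is one
    more root of X^(n / 4) - 1 that is never taken. *)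
Lemma quot_class_le i : (count (quot_class i) (iota 0 q) + (i == 0 %[mod 4]) <= n4)%N.
Proof.
rewrite -size_filter; set S := [seq _ <- _ | _].
pose s := nseq (i == 0 %[mod 4]) 1 ++ [seq qquot y | y <- S].
have Ss y : y \in S -> [/\ (y < q)%N, unit_mod y & quot_exp y = i %[mod 4]].
  by rewrite mem_filter mem_iota => /andP[/andP[? /eqP ?] /andP[_ ?]].
have := @max_poly_roots K ('X^n4 - (j ^+ i)%:P) s.
rewrite -size_poly_eq0 size_XnsubC ?quot_order_gt0 // => /(_ isT).
rewrite size_cat size_nseq size_map addnC ltnS; apply.
  rewrite all_cat all_nseq all_map; apply/andP; split.
    case: ((i %% 4)%N =P (0 %% 4)%N) => [i0|_] //=; rewrite rootE !hornerE expr1n subr_eq0.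
    by rewrite -(expr0 j) (eq_sqrtN1_expr j2 two_neq0) i0.
  apply/allP => y /Ss[_ uy yi]; rewrite /= rootE !hornerE quot_expP // subr_eq0.
  by rewrite (eq_sqrtN1_expr j2 two_neq0) yi.
rewrite cat_uniq map_inj_in_uniq; last first.
  by move=> y z /Ss[yq uy _] /Ss[zq uz _]; apply: qquot_inj.
rewrite filter_uniq ?iota_uniq // andbT; apply/andP; split; first by case: ((i %% 4)%N =P (0 %% 4)%N).
apply/hasPn => _ /mapP[y /Ss[_ uy _] ->]; case: ((i %% 4)%N =P (0 %% 4)%N) => //= _.
by rewrite inE qquot_neq1.
Qed.

(** A residue is excluded when it is a square root of - m^2; there are at most two of
    these, and none when q = 3 modulo 4, as Frobenius exchanges y + m j and y - m j. *)
Lemma count_unit_mod_ge : ((quot_order q).-1 <= count unit_mod (iota 0 q))%N.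
Proof.
have := count_predC unit_mod (iota 0 q); rewrite size_iota.
suff : (count (predC unit_mod) (iota 0 q) + (quot_order q) <= q.+1)%N.
  by have := quot_order_gt0 q_pr; move: (count _ _) (count _ _) => a b; lia.
rewrite -size_filter; set S := [seq _ <- _ | _].
have Ss y : y \in S -> (y < q)%N /\ ~~ unit_mod y.
  by rewrite mem_filter mem_iota => /andP[? /andP[_ ?]].
rewrite /quot_order; case: eqP => [q4|/qmod4_not1 q4]; last first.
  suff -> : S = [::] by [].
  case: S Ss => // y S /(_ y); rewrite mem_head => /(_ isT)[_].
  have [E1 E2] := gint_frob3 y q4; have q0 : (0 < q)%N by exact: odd_gt0.
  have := gint_neq_gconj y; rewrite unit_modE => gg.
  have -> : gint y != 0.
    apply: contra gg => /eqP g0; move: E1; rewrite g0 expr0n (gtn_eqF q0) /=.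
    by move=> <-.
  rewrite /= negbK => /eqP gc0; case/eqP: gg.
  by move: E2; rewrite gc0 expr0n (gtn_eqF q0) /= => <-.
suff : (size S <= 2)%N by have := prime_gt0 q_pr; lia.
have := @max_poly_roots K ('X^2 - (- m%:~R ^+ 2)%:P) [seq y%:R | y <- S].
rewrite -size_poly_eq0 size_XnsubC // size_map => /(_ isT); apply.
  rewrite all_map; apply/allP => y /Ss[_]; rewrite /= rootE !hornerE opprK.
  rewrite /unit_mod negbK (dvdz_pcharf charK) rmorphD !rmorphXn //.
rewrite map_inj_in_uniq ?filter_uniq ?iota_uniq // => y z /Ss[yq _] /Ss[zq _].
exact: natr_inj_mod.
Qed.

Lemma count_quot_class_split (s : seq nat) : count unit_mod s =
  (count (quot_class 0) s + count (quot_class 1) s + count (quot_class 2) s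
   + count (quot_class 3) s)%N.
Proof.
elim: s => //= y s ->.
have -> : (unit_mod y = quot_class 0 y + quot_class 1 y + quot_class 2 y
                        + quot_class 3 y :> nat)%N.
  rewrite /quot_class; case: (unit_mod y) => //=.
  have := ltn_pmod (quot_exp y) (isT : (0 < 4)%N).
  by case: (quot_exp y %% 4)%N => [|[|[|[|k]]]].
by rewrite !addnA; clear; lia.
Qed.

(** The upper bounds of [quot_class_le] add up to n - 1, which is at most the number of
    residues to be distributed. *)
Lemma quot_class_count i : (i < 4)%N ->
  (count (quot_class i) (iota 0 q) + (i == 0))%N = n4.
Proof.
move=> i4; have := count_unit_mod_ge; rewrite count_quot_class_split.
rewrite [X in (X.-1 <= _)%N]quot_orderE; have := quot_order_gt0 q_pr.
have := quot_class_le 0; have := quot_class_le 1; have := quot_class_le 2.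
have := quot_class_le 3; rewrite !(modn_small (d := 4)) //=.
by case: i i4 => [|[|[|[|]]]] // _; lia.
Qed.

End Distribution.
End QuotientModQ.

(** The properties of [quot_exp] that do not mention the field in which it is
    computed, so that one family of exponents can be chosen for all q. *)
Definition residue_exponent (m : int) (q : nat) (e : nat -> nat) : Prop :=
  [/\ forall y z, y = z %[mod q] -> e y = e z,
      forall p x, prime p -> p%:Z = m ^+ 2 + x%:Z ^+ 2 -> (2 %| m)%Z -> odd x ->
        q != p -> qexp (qroot p m x) (signed_prime q)%:~R = e x %[mod 4],
      (q%:Z %| m)%Z -> forall y, unit_mod q m y -> e y = 0 %[mod 4] &
      ~~ (q%:Z %| m)%Z -> forall i, (i < 4)%N ->
        (count (fun y => unit_mod q m y && (e y == i %[mod 4])) (iota 0 q) + (i == 0)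
         = quot_order q %/ 4)%N].

Lemma exists_residue_exponent (m : int) (q : nat) : prime q -> odd q ->
  exists e, residue_exponent m q e.
Proof.
move=> q_pr q_odd; have [K qK] := exists_closed_pchar q_pr.
have [j j2] := exists_sqrtN1 K.
exists (quot_exp q m j); split.
- by move=> y z; apply: quot_exp_period.
- move=> p x; exact: quot_exp_reciprocity.
- move=> qm y; exact: quot_exp_dvd.
by move=> qm i; apply: quot_class_count.
Qed.

Lemma exists_residue_exponents (m : int) : exists e : nat -> nat -> nat,
  forall q, prime q -> odd q -> residue_exponent m q (e q).
Proof.
have H q : exists e, prime q -> odd q -> residue_exponent m q e.
  have [q_pr|q_npr] := boolP (prime q); last by exists id.
  have [q_odd|q_nodd] := boolP (odd q); last by exists id.
  by have [e eP] := exists_residue_exponent m q_pr q_odd; exists e.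
by have [e eP] := boolp.choice H; exists e.
Qed.

(** * The trace condition as a congruence on x *)

Section Trace.
Variables (p : nat) (m : int) (x : nat) (h : int).
Hypothesis p_pr : prime p.
Hypothesis p_sum : p%:Z = m ^+ 2 + x%:Z ^+ 2.
Hypothesis mh : m = h * 2.
Hypothesis x_odd : odd x.
Local Notation f := (qroot p m x).
Let m_even : (2 %| m)%Z. Proof. by rewrite mh dvdz_mull. Qed.
Let c4 := card_Fp_mod4 p_pr p_sum m_even x_odd.
Let f2 := qroot_sqr p_pr p_sum x_odd.
Local Notation E n := (qexp f (n : int)%:~R).

Lemma qexp_N1_sum_squares : (4 %| (E (-1))%:Z - m)%Z.
Proof.
have := qexpN1 c4 f2; rewrite card_Fp // => E1.
have -> : E (-1) = qexp f (-1) by congr qexp; rewrite rmorphN.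
have p4 := sum_squares_mod4 p_pr p_sum m_even x_odd.
have [k xk] : exists k, x = (2 * k + 1)%N.
  by exists x./2; have := odd_double_half x; rewrite x_odd; lia.
have : (8 %| p%:Z - 1 - 4 * h ^+ 2)%Z.
  have -> : p%:Z - 1 - 4 * h ^+ 2 = 4 * (k%:Z ^+ 2 - k%:Z + 2 * k%:Z).
    by rewrite p_sum mh xk PoszD PoszM; ring.
  by have [r ->] := dvdzP (two_dvd_sqr_sub k); apply/dvdzP; exists (r + k%:Z); ring.
have := two_dvd_sqr_sub h.
have := prime_gt0 p_pr; move: (qexp f (-1)) p4 E1 mh (h ^+ 2); clear.
by move=> e p4 E1 -> h2 p0 H2 H8; lia.
Qed.

Lemma Fp_nat_neq0 (N n : nat) : ~~ (p %| N)%N -> (n %| N)%N -> n%:R != 0 :> 'F_p.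
Proof.
move=> pN nN; rewrite -(dvdn_pcharf (pchar_Fp p_pr)); apply: contra pN => pn.
exact: dvdn_trans nN.
Qed.

Lemma Fp_N1_neq0 : -1 != 0 :> 'F_p.
Proof. by rewrite oppr_eq0 oner_neq0. Qed.

Section Multiplicative.
Variable e : nat -> nat -> nat.
Hypothesis eP : forall q, prime q -> odd q -> residue_exponent m q (e q).

Lemma qexp_prime (l : nat) : prime l -> odd l -> l != p ->
  (4 %| (qexp f l%:R)%:Z - ((e l x)%:Z + m * (three_mod4 l)%:Z))%Z.
Proof.
move=> l_pr l_odd lp; have [_ rec _ _] := eP l_pr l_odd.
have := rec _ _ p_pr p_sum m_even x_odd lp.
have l0 : l%:R != 0 :> 'F_p by rewrite -(dvdn_pcharf (pchar_Fp p_pr)) dvdn_prime2 // eq_sym.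
have := odd_mod l (erefl : odd 4 = false); rewrite l_odd /signed_prime /three_mod4.
have := ltn_pmod l (isT : (0 < 4)%N); case: (l %% 4)%N => [|[|[|[|]]]] //= _ _.
  by rewrite -pmulrn mulr0 addr0; move: (qexp _ _) (e l x); clear; lia.
rewrite rmorphN /= -pmulrn -mulN1r (qexpM c4 f2 Fp_N1_neq0 l0) mulr1.
have := qexp_N1_sum_squares; rewrite rmorphN /=.
move: (qexp _ _) (qexp _ _) (e l x) mh; clear => a b c mh.
by rewrite mh; lia.
Qed.

(** Removing one prime factor l at a time, with l = +-[signed_prime l]. The exponent
    of -1 is m modulo 4, and 2 m vanishes modulo 4, so only the class of N modulo 4
    enters. *)
Lemma qexp_odd_nat (N : nat) (G : nat -> nat) : odd N -> ~~ (p %| N)%N ->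
  G 1%N = 0 %[mod 4] ->
  (forall l n, prime l -> (0 < n)%N -> (l * n %| N)%N ->
     G (l * n)%N = e l x + G n %[mod 4]) ->
  (4 %| (qexp f N%:R)%:Z - ((G N)%:Z + m * (three_mod4 N)%:Z))%Z.
Proof.
move=> N_odd pN G1 GM.
suff : forall n, (0 < n)%N -> (n %| N)%N ->
    (4 %| (qexp f n%:R)%:Z - ((G n)%:Z + m * (three_mod4 n)%:Z))%Z.
  by apply; rewrite ?odd_gt0.
apply: prime_mul_ind => [_|l n l_pr n0 IH lnN].
  have := qexp1 c4 f2; rewrite /three_mod4 /= mulr0 addr0.
  by move: (qexp _ _) (G 1%N) G1; clear; lia.
have lN : (l %| N)%N by apply: dvdn_trans lnN; apply: dvdn_mulr.
have nN : (n %| N)%N by apply: dvdn_trans lnN; apply: dvdn_mull.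
have l_odd := dvdn_odd lN N_odd; have n_odd := dvdn_odd nN N_odd.
have lp : l != p by apply: contra pN => /eqP <-.
have := qexpM c4 f2 (Fp_nat_neq0 pN lN) (Fp_nat_neq0 pN nN); rewrite -natrM.
have := qexp_prime l_pr l_odd lp; have := IH nN; have := GM _ _ l_pr n0 lnN.
rewrite (three_mod4M l_odd n_odd).
move: (qexp f l%:R) (qexp f n%:R) (qexp f (l * n)%:R) (G n) (G (l * n)%N) (e l x).
move: (three_mod4 l) (three_mod4 n) mh; clear => b1 b2 mh a b c d g k.
by rewrite mh; case: b1; case: b2; lia.
Qed.

Lemma qexp_divisor_m (d : nat) : odd d -> ~~ (p %| d)%N ->
  (forall q, prime q -> (q %| d)%N -> (q%:Z %| m)%Z) ->
  (4 %| (qexp f d%:R)%:Z - m * (three_mod4 d)%:Z)%Z.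
Proof.
move=> d_odd pd dm; rewrite -[m * _]add0r.
apply: (@qexp_odd_nat d (fun=> 0%N)) => // l n l_pr _ lnd.
have ld : (l %| d)%N by apply: dvdn_trans lnd; apply: dvdn_mulr.
have [_ _ triv _] := eP l_pr (dvdn_odd ld d_odd).
rewrite addn0; symmetry; apply: triv; first exact: dm.
rewrite /unit_mod addrC -p_sum; apply: contra pd => lp.
by move: ld; move: lp; rewrite -[(_ %| _)%Z]/(l %| p)%N dvdn_prime2 // => /eqP ->.
Qed.

Lemma qexp_squarefree (n : nat) : (0 < n)%N -> odd n -> squarefree n ->
  ~~ (p %| n)%N ->
  (4 %| (qexp f n%:R)%:Z -
     ((\sum_(q <- primes n) e q x)%N%:Z + m * (three_mod4 n)%:Z))%Z.
Proof.
move=> n0 n_odd n_sf pn.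
apply: (@qexp_odd_nat n (fun k => \sum_(q <- primes k) e q x)%N) => //.
  by rewrite big_nil.
move=> l k l_pr k0 lkn; congr (_ %% _)%N.
have lk := squarefree_ndvd l_pr n_sf lkn.
by rewrite (perm_big _ (perm_primes_prime_mul l_pr k0 lk)) big_cons.
Qed.

End Multiplicative.
End Trace.

Section Condition.
Variables (p : nat) (m : int) (x : nat) (h : int).
Hypothesis p_pr : prime p.
Hypothesis p_sum : p%:Z = m ^+ 2 + x%:Z ^+ 2.
Hypothesis mh : m = h * 2.
Hypothesis m0 : m != 0.
Hypothesis x_odd : odd x.
Local Notation f := (qroot p m x).
Let m_even : (2 %| m)%Z. Proof. by rewrite mh dvdz_mull. Qed.
Let c4 := card_Fp_mod4 p_pr p_sum m_even x_odd.
Let f2 := qroot_sqr p_pr p_sum x_odd.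

(** As m is even and x is odd, the left hand side can be m only for odd e, and then
    its sign must be 1; here eps = x (1 - m) modulo 4 because x^2 = 1 modulo 8. *)
Lemma re4_im4_eq (e : nat) (eps : int) : (eps == 1) || (eps == -1) ->
  (exists k, eps * x%:Z + m = 1 + 4 * k) ->
  (re4 e * (eps * x%:Z) + im4 e * (eps * m) == m) =
  (4 %| e%:Z - x%:Z * (1 - m))%Z.
Proof.
have [k xk] : exists k, x = (2 * k + 1)%N.
  by exists x./2; have := odd_double_half x; rewrite x_odd; clear; lia.
move=> epsP [r er]; rewrite -re4_mod -im4_mod.
have eE := divn_eq e 4; have : (e %% 4 < 4)%N by rewrite ltn_mod.
have xm : x%:Z * (1 - m) = x%:Z - 2 * h - 4 * (k%:Z * h).
  by rewrite mh xk PoszD PoszM; ring.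
rewrite xm; move: (k%:Z * h) m0 mh er eE epsP xk.
move: (e %/ 4)%N (e %% 4)%N; clear => q r4 kh m0 mh er eE epsP xk r4P.
have R0 : re4 0 = 1 by []. have R1 : re4 1 = 0 by []. have R2 : re4 2 = -1 by [].
have R3 : re4 3 = 0 by []. have I0 : im4 0 = 0 by []. have I1 : im4 1 = 1 by [].
have I2 : im4 2 = 0 by []. have I3 : im4 3 = -1 by [].
case/orP: epsP => /eqP eps1; rewrite eps1 in er *;
  case: r4 eE r4P => [|[|[|[|//]]]] eE _; rewrite ?(R0, R1, R2, R3) ?(I0, I1, I2, I3);
  clear R0 R1 R2 R3 I0 I1 I2 I3; apply/eqP/idP; lia.
Qed.

(** The condition chi(-D) = eps i. *)
Lemma ap_eq (D : int) : ~~ (p%:Z %| D)%Z ->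
  (ap D p == 2 * m) = (4 %| (qexp f (- D)%:~R)%:Z - x%:Z * (1 - m))%Z.
Proof.
move=> pD; have D0 : D%:~R != 0 :> 'F_p by rewrite Fp_intr_eq0.
have [eps [epsP aE bE eps4]] := primary_sign p_pr p_sum m_even x_odd.
have := curve_trace c4 f2 D0; rewrite card_Fp // aE bE.
have -> : ap D p = p%:Z - #|[pred P : 'F_p * 'F_p | P.2 ^+ 2 == P.1 ^+ 3 + D%:~R * P.1]|%:Z.
  by rewrite /ap /npoints; move: #|_|; clear; lia.
move=> ->; rewrite rmorphN /= -(re4_im4_eq _ epsP eps4).
by rewrite (inj_eq (mulfI _)).
Qed.

Lemma x_mul_h : [/\ (2 %| h)%Z -> (4 %| x%:Z * h - h)%Z,
  (4 %| h - 1)%Z -> (4 %| x%:Z * h - x%:Z)%Z &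
  (4 %| h + 1)%Z -> (4 %| x%:Z * h + x%:Z)%Z].
Proof.
have [k xk] : exists k, x%:Z = 2 * k + 1.
  by exists (x./2)%:Z; have := odd_double_half x; rewrite x_odd; clear; lia.
split=> /dvdzP[r hr]; apply/dvdzP; rewrite xk.
- by exists (r * k); rewrite hr; ring.
- by exists (r * (2 * k + 1)); rewrite -[h](subrK 1) hr; ring.
by exists (r * (2 * k + 1)); rewrite -[h](addrK 1) hr; ring.
Qed.

(** Multiplicativity gives -D the exponent m (1 + s + ...) + x h + T, where T
    collects the symbols at the prime factors of dbar. Subtracting x (1 - m) leaves a
    multiple of 2 when h is odd, and an odd number depending on x when h is even. *)
Lemma ap_condition (e : nat -> nat -> nat) (D : int) (s : bool) (d dp dq dl : nat) :
  (forall q, prime q -> odd q -> residue_exponent m q (e q)) ->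
  D = d%:Z * ((-1) ^+ s * (2 * dp * dq ^ 2 * dl ^ 3)%N%:Z) ->
  ~~ (p%:Z %| D)%Z -> odd d ->
  (forall q, prime q -> (q %| d)%N -> (q%:Z %| m)%Z) ->
  [/\ (0 < dp)%N, odd dp & squarefree dp] ->
  [/\ (0 < dq)%N, odd dq & squarefree dq] ->
  [/\ (0 < dl)%N, odd dl & squarefree dl] ->
  let T := (\sum_(q <- primes dp) e q x + 2 * \sum_(q <- primes dq) e q x
            + 3 * \sum_(q <- primes dl) e q x)%N in
  (ap D p == 2 * m) =
  if (2 %| h)%Z then (4 %| T%:Z - (x%:Z + h))%Z
  else (4 %| T%:Z - 2 * (s + three_mod4 d + three_mod4 dp + three_mod4 dl
                          + (4 %| (h + 1)%R)%Z)%N%:Z)%Z.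
Proof.
move=> eP DE pD d_odd dm [dp0 dp_odd dp_sf] [dq0 dq_odd dq_sf] [dl0 dl_odd dl_sf] T.
have pn (n : nat) : (n%:Z %| D)%Z -> ~~ (p %| n)%N.
  by move=> nD; apply: contra pD => pn; apply: dvdz_trans nD.
rewrite (ap_eq pD).
have pd : ~~ (p %| d)%N by apply: pn; rewrite DE dvdz_mulr.
have N1 n : (n %| 2 * dp * dq ^ 2 * dl ^ 3)%N -> ~~ (p %| n)%N.
  move=> nN; apply: pn; rewrite DE dvdz_mull // dvdz_mull //.
have pdp : ~~ (p %| dp)%N by apply: N1; rewrite -!mulnA dvdn_mull // dvdn_mulr.
have pdq : ~~ (p %| dq)%N.
  by apply: N1; rewrite dvdn_mulr // dvdn_mull // expnS dvdn_mulr.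
have pdl : ~~ (p %| dl)%N by apply: N1; rewrite dvdn_mull // expnS dvdn_mulr.
have F2 : 2 != 0 :> 'F_p := F_two_neq0 c4.
have Fn n : ~~ (p %| n)%N -> n%:R != 0 :> 'F_p by rewrite (dvdn_pcharf (pchar_Fp p_pr)).
have Ed := qexp_divisor_m p_pr p_sum mh x_odd eP d_odd pd dm.
have Ep := qexp_squarefree p_pr p_sum mh x_odd eP dp0 dp_odd dp_sf pdp.
have Eq := qexp_squarefree p_pr p_sum mh x_odd eP dq0 dq_odd dq_sf pdq.
have El := qexp_squarefree p_pr p_sum mh x_odd eP dl0 dl_odd dl_sf pdl.
have E1 : (4 %| (qexp f (-1)%R)%:Z - m)%Z.
  by have := qexp_N1_sum_squares p_pr p_sum mh x_odd; rewrite rmorphN1.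
have E2 := qexp_two p_pr p_sum m_even x_odd mh.
have ND : (- D)%:~R = (-1) ^+ s.+1 * (d%:R * (2 * (dp%:R * (dq%:R ^+ 2 * dl%:R ^+ 3)))) :> 'F_p.
  rewrite DE rmorphN !rmorphM /= rmorphXn /= -!pmulrn !natrM ?natrX rmorphN1 exprS.
  by ring.
have nz2 : dq%:R ^+ 2 * dl%:R ^+ 3 != 0 :> 'F_p by rewrite mulf_neq0 ?expf_neq0 ?Fn.
have nzp : dp%:R * (dq%:R ^+ 2 * dl%:R ^+ 3) != 0 :> 'F_p by rewrite mulf_neq0 ?Fn.
have nz22 : 2 * (dp%:R * (dq%:R ^+ 2 * dl%:R ^+ 3)) != 0 :> 'F_p by rewrite mulf_neq0.
have nzd : d%:R * (2 * (dp%:R * (dq%:R ^+ 2 * dl%:R ^+ 3))) != 0 :> 'F_p by rewrite mulf_neq0 ?Fn.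
have N10 := Fp_N1_neq0 p.
have M1 := qexpM c4 f2 (expf_neq0 s.+1 N10) nzd.
have M2 := qexpX c4 f2 s.+1 N10.
have M3 := qexpM c4 f2 (Fn _ pd) nz22.
have M4 := qexpM c4 f2 F2 nzp.
have M5 := qexpM c4 f2 (Fn _ pdp) nz2.
have M6 := qexpM c4 f2 (expf_neq0 2 (Fn _ pdq)) (expf_neq0 3 (Fn _ pdl)).
have M7 := qexpX c4 f2 2 (Fn _ pdq).
have M8 := qexpX c4 f2 3 (Fn _ pdl).
rewrite ND; have [A1 A2 A3] := x_mul_h.
have -> : x%:Z * (1 - m) = x%:Z - 2 * (x%:Z * h) by rewrite mh; ring.
rewrite /T; clear T pn N1 Fn F2 nz2 nzp nz22 nzd N10 pD DE eP dm pd pdp pdq pdl ND.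
clear d_odd dp0 dp_odd dp_sf dq0 dq_odd dq_sf dl0 dl_odd dl_sf.
move: M1 M2 M3 M4 M5 M6 M7 M8 Ed Ep Eq El E1 E2 A1 A2 A3 mh x_odd.
move: (\sum_(q <- primes dp) _)%N (\sum_(q <- primes dq) _)%N (\sum_(q <- primes dl) _)%N.
move=> Tp Tq Tl.
move: (qexp f ((-1) ^+ s.+1 * _)) (qexp f ((-1) ^+ s.+1)) (qexp f (-1)).
move: (qexp f (d%:R * _)) (qexp f (2 * _)) (qexp f (dp%:R * _)) (qexp f (_ ^+ 2 * _)).
move: (qexp f (_ ^+ 2)) (qexp f (_ ^+ 3)) (qexp f 2).
move: (qexp f d%:R) (qexp f dp%:R) (qexp f dq%:R) (qexp f dl%:R).
move: (three_mod4 d) (three_mod4 dp) (three_mod4 dq) (three_mod4 dl) (x%:Z * h).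
clear=> b1 b2 b3 b4 xh a1 a2 a3 a4 a5 a6 a7 a8 a9 a10 a11 a12 a13 a14.
move=> M1 M2 M3 M4 M5 M6 M7 M8 E1 E2 E3 E4 E5 E6 A1 A2 A3 mh x_odd.
have mb (b : bool) : (4 %| m * b%:Z - 2 * (~~ (2 %| h)%Z && b)%:Z)%Z.
  by rewrite mh; clear; case: b => /=; lia.
have := mb b1; have := mb b2; have := mb b3; have := mb b4; clear mb.
move: E1 E2 E3 E4; move: (m * b1%:Z) (m * b2%:Z) (m * b3%:Z) (m * b4%:Z).
move=> m1 m2 m3 m4 E1 E2 E3 E4 F4 F3 F2 F1.
have M2' : (4 %| a13%:Z - m - 2 * (~~ (2 %| h)%Z && s)%:Z)%Z.
  by move: M2 E5 mh; clear; case: s => M2 E5 mh; lia.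
have H12 : (4 %| a12%:Z - (Tp%:Z + 2 * Tq%:Z + 3 * Tl%:Z + xh + m + m1 + m2 + 2 * m3
     + 3 * m4 + 2 * (~~ (2 %| h)%Z && s)%:Z))%Z.
  clear - M1 M2' M3 M4 M5 M6 M7 M8 E1 E2 E3 E4 E5 E6; lia.
move: H12 F1 F2 F3 F4 A1 A2 A3 mh x_odd; clear.
case h2: (2 %| h)%Z; rewrite ?andbF ?andbT /=.
  move=> H12 F1 F2 F3 F4 /(_ isT) A1 _ _ mh x_odd.
  by apply/idP/idP; lia.
move=> H12 F1 F2 F3 F4 _ A2 A3 mh x_odd.
have [k xk] : exists k, x%:Z = 2 * k + 1.
  by exists (x./2)%:Z; have := odd_double_half x; rewrite x_odd; clear; lia.
case h3: (4 %| h + 1)%Z A3 => A3 /=.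
  move: (A3 isT) => {}A3; clear A2; apply/idP/idP; lia.
have h1 : (4 %| h - 1)%Z by clear - h2 h3; lia.
move: (A2 h1) => {}A2; clear A3; apply/idP/idP; lia.
Qed.

End Condition.

(** * Counting residues by the Chinese remainder theorem *)

Lemma count_allpairs_and (A B : pred nat) (s t : seq nat) :
  count (fun u => A u.1 && B u.2) [seq (a, b) | a <- s, b <- t] =
  (count A s * count B t)%N.
Proof.
elim: s => //= a s IH; rewrite count_cat IH mulnDl count_map; congr (_ + _)%N.
case Aa: (A a).
  by rewrite mul1n; apply: eq_count => b /=; rewrite Aa.
by rewrite mul0n (eq_count (a2 := pred0)) ?count_pred0 // => b /=; rewrite Aa.
Qed.

Lemma count_crt (q P : nat) (A B : pred nat) : coprime q P -> (0 < q)%N -> (0 < P)%N ->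
  (forall y, A (y %% q)%N = A y) -> (forall y, B (y %% P)%N = B y) ->
  count (fun y => A y && B y) (iota 0 (q * P)) =
  (count A (iota 0 q) * count B (iota 0 P))%N.
Proof.
move=> co q0 P0 Aq BP; rewrite -count_allpairs_and.
rewrite (eq_count (a2 := preim (fun y => (y %% q, y %% P)%N) (fun u => A u.1 && B u.2))); last first.
  by move=> y /=; rewrite Aq BP.
rewrite -count_map; apply/permP.
have U : uniq [seq ((y %% q)%N, (y %% P)%N) | y <- iota 0 (q * P)].
  rewrite map_inj_in_uniq ?iota_uniq // => y z; rewrite !mem_iota !add0n /=.
  move=> yP zP [E1 E2]; rewrite -(modn_small yP) -(modn_small zP).
  by apply/eqP; rewrite chinese_remainder // E1 E2 !eqxx.
have V : uniq [seq (a, b) | a <- iota 0 q, b <- iota 0 P].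
  by apply: allpairs_uniq; rewrite ?iota_uniq // => -[? ?] [? ?] _ _ [-> ->].
apply: uniq_perm => //.
have sub : {subset [seq ((y %% q)%N, (y %% P)%N) | y <- iota 0 (q * P)]
            <= [seq (a, b) | a <- iota 0 q, b <- iota 0 P]}.
  move=> u /mapP[y _ ->]; apply/allpairsP; exists ((y %% q)%N, (y %% P)%N) => /=.
  by rewrite !mem_iota !add0n !ltn_mod q0 P0.
by case: (uniq_min_size U sub _) => //; rewrite size_allpairs size_map !size_iota.
Qed.

Section ResidueCount.
Variables (m : int) (e : nat -> nat -> nat).

Definition wexponent (L : seq (nat * nat)) (y : nat) : nat :=
  (\sum_(u <- L) u.2 * e u.1 y)%N.
Definition wmodulus (L : seq (nat * nat)) : nat := (\prod_(u <- L) u.1)%N.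
Definition wunit (L : seq (nat * nat)) (y : nat) : bool :=
  all (fun u => unit_mod u.1 m y) L.
Definition wcount (L : seq (nat * nat)) (t : nat) : nat :=
  count (fun y => wunit L y && (wexponent L y == t %[mod 4])%N) (iota 0 (wmodulus L)).

Definition weight_ok (u : nat * nat) : bool :=
  [&& prime u.1, odd u.1, ~~ (u.1%:Z %| m)%Z & (0 < u.2 < 4)%N].

Hypothesis eP : forall q, prime q -> odd q -> residue_exponent m q (e q).

Lemma unit_mod_period q y z : y = z %[mod q] -> unit_mod q m y = unit_mod q m z.
Proof.
move=> yz; rewrite /unit_mod; congr (~~ _).
have H w : (q%:Z %| w%:Z ^+ 2 + m ^+ 2)%Z = (q%:Z %| (w %% q)%N%:Z ^+ 2 + m ^+ 2)%Z.
  rewrite {1}(divn_eq w q) PoszD PoszM.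
  have -> : ((w %/ q)%N%:Z * q%:Z + (w %% q)%N%:Z) ^+ 2 + m ^+ 2 =
    ((w %/ q)%N%:Z ^+ 2 * q%:Z + 2 * (w %/ q)%N%:Z * (w %% q)%N%:Z) * q%:Z +
    ((w %% q)%N%:Z ^+ 2 + m ^+ 2) by ring.
  by rewrite rpredDl // dvdz_mull.
by rewrite H yz -H.
Qed.

Lemma wunit_wexponent_period L y : all weight_ok L ->
  wunit L (y %% wmodulus L) = wunit L y /\ wexponent L (y %% wmodulus L) = wexponent L y.
Proof.
move=> Lok; have M u z : u \in L -> (z %% wmodulus L = z %[mod u.1])%N.
  move=> uL; rewrite modn_dvdm // /wmodulus.
  by rewrite (perm_big _ (perm_to_rem uL)) big_cons dvdn_mulr.
split.
  by apply: eq_in_all => u uL; apply/unit_mod_period/M.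
apply: eq_big_seq => u uL; have /and4P[u_pr u_odd _ _] := allP Lok _ uL.
by have [per _ _ _] := eP u_pr u_odd; rewrite (per _ y) // M.
Qed.

(** The Chinese remainder theorem, the residues modulo q being sorted by their
    exponent i; 3 c i stands for - c i modulo 4. *)
Lemma wcount_cons q c L t : weight_ok (q, c) -> all weight_ok L -> q \notin map fst L ->
  wcount ((q, c) :: L) t =
  \sum_(i < 4) ((quot_order q %/ 4 - (i == 0 :> nat)) * wcount L (t + 3 * (c * i)))%N.
Proof.
move=> qok Lok qL; have /and4P[q_pr q_odd qm c4] := qok.
have [per _ _ dist] := eP q_pr q_odd.
have q0 := prime_gt0 q_pr.
have P0 : (0 < wmodulus L)%N.
  rewrite /wmodulus; elim: {qL} L Lok => [|u L IH] /=; first by rewrite big_nil.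
  by case/andP=> /and4P[u_pr _ _ _] /IH P0; rewrite big_cons muln_gt0 prime_gt0.
have co : coprime q (wmodulus L).
  rewrite /wmodulus; elim: L Lok qL {P0} => [|u L IH] /=; first by rewrite big_nil coprimen1.
  case/andP=> /and4P[u_pr _ _ _] /IH {}IH; rewrite in_cons negb_or => /andP[qu qL].
  by rewrite big_cons coprimeMr IH // prime_coprime // dvdn_prime2 // qu.
pose A (i : nat) (y : nat) := unit_mod q m y && (e q y == i %[mod 4])%N.
pose B (i : nat) (y : nat) := wunit L y && (wexponent L y == i %[mod 4])%N.
transitivity (\sum_(i < 4) count (fun y => A i y && B (t + 3 * (c * i))%N y)
                (iota 0 (q * wmodulus L)))%N; last first.
  apply: eq_bigr => i _; rewrite count_crt //.
  - congr (_ * _)%N; apply/eqP; rewrite -(eqn_add2r (i == 0 :> nat)).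
    rewrite dist // subnK //.
    apply: leq_trans (_ : 1 <= _)%N; first by case: (_ == _).
    exact: quot_order_gt0.
  - by move=> y; rewrite /A (unit_mod_period (modn_mod y q)) (per _ y) // modn_mod.
  by move=> y; rewrite /B; have [-> ->] := wunit_wexponent_period y Lok.
rewrite /wcount {1}/wmodulus big_cons -/(wmodulus L).
elim: (iota 0 _) => [|y s IH] /=; first by rewrite big1.
rewrite big_split /= -IH; congr (_ + _)%N.
rewrite /wexponent big_cons -/(wexponent L y) /= /A /B.
case: (unit_mod q m y) => /=; last by rewrite big1.
case: (wunit L y) => /=; last by rewrite big1 // => i _; rewrite andbF.
move: (e q y) (wexponent L y) c4; clear => a b /andP[c0 c4].
have lt4 := ltn_pmod a (isT : (0 < 4)%N).
rewrite (bigD1 (Ordinal lt4)) //= modn_mod eqxx big1 ?addn0 => [|i]; last first.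
  move=> ia; case: eqP => //= E; case/negP: ia; apply/eqP/val_inj.
  by rewrite /= E modn_small.
congr nat_of_bool; move: c0 c4; case: c => [|[|[|[|]]]] //= _ _; apply/eqP/eqP; lia.
Qed.

Definition fourier0 (L : seq (nat * nat)) : int := \prod_(u <- L) ((quot_order u.1)%:Z - 1).
Definition fourier1 (L : seq (nat * nat)) : int := (-1) ^+ size L.
Definition fourier2 (L : seq (nat * nat)) : int :=
  \prod_(u <- L) (if u.2 == 2%N then (quot_order u.1)%:Z - 1 else -1).

(** The four counts are the inverse Fourier transform on Z/4 of the sums of i^(k T)
    over the admissible residues, which are products of local sums: [fourier0] for
    k = 0, [fourier1] for k odd and [fourier2] for k = 2. *)
Lemma wcount_fourier L t : all weight_ok L -> uniq (map fst L) ->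
  4 * (wcount L t)%:Z = fourier0 L + (-1) ^+ t * fourier2 L + 2 * re4 t * fourier1 L.
Proof.
elim: L t => [|[q c] L IH] t.
  move=> _ _; rewrite /wcount /wunit /wexponent /wmodulus.
  rewrite /fourier0 /fourier2 /fourier1 !big_nil /= addn0 big_nil.
  rewrite -re4_mod -signr_odd -(odd_mod t (erefl : odd 4 = false)).
  by have := ltn_pmod t (isT : (0 < 4)%N); case: (t %% 4)%N => [|[|[|[|]]]].
move=> /= /andP[qok Lok] /andP[qL Lu]; rewrite wcount_cons //.
have {}IH k := IH k Lok Lu.
have /and4P[q_pr q_odd qm /andP[c0 c4]] := qok.
have k0 : (0 < quot_order q %/ 4)%N by exact: quot_order_gt0.
rewrite /fourier0 /fourier1 /fourier2 !big_cons -/(fourier0 L) -/(fourier2 L) /= exprS -/(fourier1 L).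
have qE := quot_orderE q_odd; move: k0 qE.
move: (quot_order q) (quot_order q %/ 4)%N => n k k0 ->.
rewrite !big_ord_recl big_ord0 /= /bump /= !addn0 !subn0 !muln0 addn0 muln1 !PoszD !PoszM.
have -> : (k - 1)%N%:Z = k%:Z - 1 by lia.
set w0 := wcount L t; set w1 := wcount L _; set w2 := wcount L _; set w3 := wcount L _.
transitivity ((k%:Z - 1) * (4 * w0%:Z) + k%:Z * (4 * w1%:Z) + k%:Z * (4 * w2%:Z)
              + k%:Z * (4 * w3%:Z)); first by ring.
rewrite /w0 /w1 /w2 /w3 !IH !exprD !exprM.
have R (i j : nat) : i = j %[mod 4] -> re4 (t + i) = re4 (t + j).
  by move=> ij; rewrite -re4_mod -modnDmr ij modnDmr re4_mod.
have R3 : re4 (t + 3) = - re4 (t + 1) by rewrite -[3%N]/(1 + 2)%N addnA re4_half.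
have R2 := re4_half t.
move: c0 c4 {qok qL w0 w1 w2 w3 q_pr q_odd qm}; case: c => [|[|[|[|]]]] //= _ _.
- by rewrite (R 6 2)%N // (R 9 1)%N // R3 R2; ring.
- by rewrite (R 6 2)%N // (R 12 0)%N // (R 18 2)%N // addn0 R2; ring.
by rewrite (R 9 1)%N // (R 18 2)%N // (R 27 3)%N // R3 R2; ring.
Qed.

Lemma count_wunit L : all weight_ok L -> uniq (map fst L) ->
  (count (wunit L) (iota 0 (wmodulus L)))%:Z = fourier0 L.
Proof.
move=> Lok Lu.
have -> : count (wunit L) (iota 0 (wmodulus L)) =
    (wcount L 0 + wcount L 1 + wcount L 2 + wcount L 3)%N.
  rewrite /wcount; elim: (iota _ _) => //= y s ->.
  have -> : (wunit L y = (wunit L y && (wexponent L y == 0 %[mod 4])) +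
     (wunit L y && (wexponent L y == 1 %[mod 4])) + (wunit L y && (wexponent L y == 2 %[mod 4])) +
     (wunit L y && (wexponent L y == 3 %[mod 4])) :> nat)%N.
    case: (wunit L y) => //=; have := ltn_pmod (wexponent L y) (isT : (0 < 4)%N).
    by case: (wexponent L y %% 4)%N => [|[|[|[|]]]].
  by rewrite !addnA; clear; lia.
have := wcount_fourier 0 Lok Lu; have := wcount_fourier 1 Lok Lu.
have := wcount_fourier 2 Lok Lu; have := wcount_fourier 3 Lok Lu.
rewrite -[re4 0]/(1 : int) -[re4 1]/(0 : int) -[re4 2]/(-1 : int) -[re4 3]/(0 : int).
by rewrite !PoszD; clear; lia.
Qed.

End ResidueCount.

(** * Densities from the Hardy-Littlewood conjecture *)

Section Growth.
Local Open Scope classical_set_scope.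
Variable R : realType.

(** ln n = 4 ln y < 4 y for y the fourth root of n. *)
Lemma ln_div_sqrt_cvg0 : (fun n => ln (n%:R : R) / Num.sqrt (n%:R : R)) @ \oo --> (0 : R).
Proof.
apply/cvgr0Pnorm_lt => eps eps0; near=> n.
have n1 : 1 < n%:R :> R by near: n; exact: nbhs_infty_gtr.
have n0 : 0 < n%:R :> R by apply: lt_trans n1.
set s := Num.sqrt (n%:R : R); set y := Num.sqrt s.
have s0 : 0 < s by rewrite sqrtr_gt0.
have y0 : 0 < y by rewrite sqrtr_gt0.
have sE : y ^+ 2 = s by rewrite sqr_sqrtr // ltW.
have nE : y ^+ 4 = n%:R by rewrite (exprM _ 2 2) sE sqr_sqrtr // ltW.
have ye : 4 / eps < y.
  rewrite -(@ltr_pXn2r _ 4) ?nnegrE ?(ltW y0) // ?divr_ge0 ?ltW // nE.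
  by near: n; exact: nbhs_infty_gtr.
rewrite ger0_norm; last by rewrite divr_ge0 ?ln_ge0 // ltW.
rewrite -nE lnXn // -/s ltr_pdivrMr // -sE -mulr_natr.
apply: (@lt_le_trans _ _ (y * 4)); first by rewrite ltr_pM2r // ln_sublinear.
rewrite expr2 mulrCA ler_pM2l // mulrC -ler_pdivrMr //; exact: ltW.
Unshelve. all: by end_near. Qed.

Lemma cvg_sum_seq (T : eqType) (r : seq T) (u : T -> nat -> R) :
  (forall i, i \in r -> u i @ \oo --> (1 : R)) ->
  (fun n => \sum_(i <- r) u i n) @ \oo --> ((size r)%:R : R).
Proof.
elim: r => [|i r IH] H.
  under eq_cvg do rewrite big_nil.
  exact: cvg_cst.
under eq_cvg do rewrite big_cons.
rewrite /= -natr1 addrC; apply: cvgD; first by apply: H; rewrite mem_head.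
by apply: IH => k kr; apply: H; rewrite in_cons kr orbT.
Qed.

End Growth.

Section Density.
Local Open Scope classical_set_scope.
Variables (R : realType) (m : int) (M : nat).
Hypothesis HL : HardyLittlewood R.
Hypothesis m0 : m != 0.
Hypothesis M_gt0 : (0 < M)%N.
Hypothesis M_even : ~~ odd M.

Definition admissible (x : nat) : bool := coprime M (absz (x%:Z ^+ 2 + m ^+ 2)).

Let a : int := M%:Z ^+ 2.
Let b (x : nat) : int := 2 * M%:Z * x%:Z.
Let c (x : nat) : int := x%:Z ^+ 2 + m ^+ 2.

Lemma abs_a : absz a = (M ^ 2)%N.
Proof. by rewrite /a expr2 abszM. Qed.

Lemma discr_class x : discr a (b x) (c x) = discr a 0 (m ^+ 2).
Proof. by rewrite /discr /a /b /c; ring. Qed.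

Lemma discr_class_lt0 x : discr a (b x) (c x) < 0.
Proof.
rewrite discr_class /discr expr0n add0r oppr_lt0 /a.
have a0 : 0 < M%:Z ^+ 2 by rewrite exprn_gt0.
have m2 : 0 < m ^+ 2 by rewrite exprn_even_gt0.
by apply: mulr_gt0 => //; apply: mulr_gt0.
Qed.

Lemma gcdz2_even (z : int) : (2 %| z)%Z -> gcdz 2 z = 2.
Proof. by move/gcdz_idPl. Qed.

Lemma two_dvd_M : (2 %| M%:Z)%Z.
Proof. by rewrite -[(2 %| _)%Z]/(2 %| M)%N dvdn2. Qed.

(** The constant sees the class of x only through its discriminant and its divisibility
    by the primes of M, so that all admissible classes are equally likely. *)
Lemma HL_delta_class x : HL_delta R a (b x) (c x) = HL_delta R a 0 (m ^+ 2).
Proof.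
rewrite /HL_delta /HL_partial discr_class; congr (_ / _ * _ * _).
- have a2 : (2 %| a)%Z by rewrite /a expr2 dvdz_mull // two_dvd_M.
  have b2 : (2 %| b x)%Z by rewrite /b -mulrA dvdz_mulr.
  by rewrite !gcdz2_even ?addr0 // rpredD.
- rewrite big_seq_cond [RHS]big_seq_cond; apply: eq_bigl => p.
  case pa: (p \in _) => //=; congr (_ && _); rewrite dvdz0.
  move: pa; rewrite mem_primes => /and3P[p_pr _].
  rewrite Euclid_dvdM // orbb => pM.
  by rewrite /b mulrAC dvdz_mull.
Qed.

Lemma HL_class x : admissible x ->
  (fun n => (HL_count a (b x) (c x) n)%:R /
     (HL_delta R a 0 (m ^+ 2) * (Num.sqrt (n%:R : R) / ln (n%:R : R)))) @ \oo --> (1 : R).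
Proof.
move=> ax; have [] := HL (a := a) (b := b x) (c := c x).
- by rewrite exprn_gt0.
- rewrite /gcdz /=; congr Posz.
  have : coprime (absz a) (absz (c x)) by rewrite abs_a coprimeXl.
  rewrite /coprime => /eqP g1; apply/eqP; rewrite -dvdn1 -g1 dvdn_gcd.
  rewrite dvdn_gcdr andbT; apply: dvdn_trans (dvdn_gcdl _ _) _; exact: dvdn_gcdl.
- case=> _ c2; move: ax; rewrite /admissible => /eqP g1.
  have : (2 %| gcdn M (absz (c x)))%N by rewrite dvdn_gcd dvdn2 M_even.
  by rewrite g1.
- case=> k dk; have := discr_class_lt0 x; rewrite dk.
  by rewrite ltNge sqr_ge0.
by move=> _; rewrite HL_delta_class.
Qed.

Definition representable (p : nat) : bool :=
  prime p && `[< exists x : int, p%:Z = m ^+ 2 + x ^+ 2 >].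

Definition in_class (x p : nat) : bool :=
  prime p && `[< exists k : nat, p%:Z = a * k%:Z ^+ 2 + b x * k%:Z + c x >].

Lemma class_poly x k : a * k%:Z ^+ 2 + b x * k%:Z + c x =
  m ^+ 2 + (x + M * k)%N%:Z ^+ 2.
Proof. by rewrite /a /b /c PoszD PoszM; ring. Qed.

Variables (good cond : pred nat) (bound : nat).
Hypothesis condP : forall p x : nat, prime p -> p%:Z = m ^+ 2 + x%:Z ^+ 2 ->
  (bound < p)%N -> cond p = good (x %% M)%N.

Let classes := [seq x <- iota 0 M | admissible x && good x].

(** A prime p > M of the form m^2 + x^2 lies in exactly one class, that of its
    unique x >= 0, and this class is admissible because p is prime to M. *)
Lemma class_sum (p : nat) : (maxn bound M < p)%N ->
  (representable p && cond p : nat) = (\sum_(x <- classes) in_class x p)%N.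
Proof.
rewrite gtn_max => /andP[bp Mp].
have [/andP[p_pr /asboolP[z pz]]|np] := boolP (representable p); last first.
  rewrite big1 // => x _; apply/eqP; rewrite eqb0; apply: contra np.
  case/andP=> p_pr /asboolP[k pk]; rewrite /representable p_pr /=; apply/asboolP.
  by exists (x + M * k)%N%:Z; rewrite pk class_poly.
have {pz z} [x px] : exists x : nat, p%:Z = m ^+ 2 + x%:Z ^+ 2.
  by exists (absz z); rewrite abszE -normrX ger0_norm ?sqr_ge0.
set r := (x %% M)%N; have rM : (r < M)%N by rewrite ltn_mod.
have xr : x = (r + M * (x %/ M))%N by rewrite mulnC addnC -divn_eq.
have r_adm : admissible r.
  rewrite /admissible /coprime; set g := gcdn _ _.
  have gM : (g %| M)%N by exact: dvdn_gcdl.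
  have gr : (g%:Z %| r%:Z ^+ 2 + m ^+ 2)%Z by exact: dvdn_gcdr.
  have : (g%:Z %| p%:Z)%Z.
    rewrite px [in x%:Z]xr PoszD PoszM.
    have -> : m ^+ 2 + (r%:Z + M%:Z * (x %/ M)%N%:Z) ^+ 2 =
      r%:Z ^+ 2 + m ^+ 2 +
      (2 * r%:Z * (x %/ M)%N%:Z + M%:Z * (x %/ M)%N%:Z ^+ 2) * M%:Z by ring.
    by rewrite rpredD // dvdz_mull.
  rewrite -[(_ %| _)%Z]/(g %| p)%N => gp.
  have /primeP[_ /(_ g gp) /orP[//|/eqP gE]] := p_pr.
  by have := dvdn_leq M_gt0 gM; rewrite gE leqNgt Mp.
have in_r y : (y < M)%N -> in_class y p = (y == r).
  move=> yM; rewrite /in_class p_pr /=; apply/asboolP/eqP => [[k]|->]; last first.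
    by exists (x %/ M)%N; rewrite class_poly -xr.
  rewrite class_poly px => /addrI /eqP; rewrite eqrXn2 // eqz_nat => /eqP xE.
  by rewrite /r xE mulnC addnC modnMDl modn_small.
rewrite /= (condP p_pr px bp) -/r.
rewrite /classes big_filter big_mkcond /=.
rewrite (bigD1_seq r) ?iota_uniq ?mem_iota //= r_adm in_r // eqxx /=.
rewrite big1_seq ?addn0; last first.
  move=> y /andP[yr]; rewrite mem_iota add0n => yM.
  by rewrite in_r // (negPf yr) if_same.
by case: (good r).
Qed.

Definition HL_scale (n : nat) : R :=
  HL_delta R a 0 (m ^+ 2) * (Num.sqrt (n%:R : R) / ln (n%:R : R)).

Lemma HL_scale_inv_cvg0 (k : R) : (fun n => k / HL_scale n) @ \oo --> (0 : R).
Proof.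
have -> : (fun n => k / HL_scale n) = (fun n => (k / HL_delta R a 0 (m ^+ 2)) *
    (ln (n%:R : R) / Num.sqrt (n%:R : R))).
  by apply: funext => n; rewrite /HL_scale invfM invf_div !mulrA.
rewrite -[X in _ --> X](mulr0 (k / HL_delta R a 0 (m ^+ 2))).
by apply: cvgM; [exact: cvg_cst | exact: ln_div_sqrt_cvg0].
Qed.

(** By [class_sum] the two counts grow in the same way beyond a bound. *)
Lemma count_classes : exists k : R, forall n, (maxn bound M < n)%N ->
  (count (fun p => representable p && cond p) (iota 0 n))%:R =
  (\sum_(x <- classes) HL_count a (b x) (c x) n)%:R + k.
Proof.
set B := (maxn bound M).+1.
exists ((count (fun p => representable p && cond p) (iota 0 B))%:R -
        (\sum_(x <- classes) HL_count a (b x) (c x) B)%:R) => n Bn.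
have H : (\sum_(x <- classes) HL_count a (b x) (c x) n =
          \sum_(x <- classes) HL_count a (b x) (c x) B +
          count (fun p => representable p && cond p) (iota B (n - B)))%N.
  have -> : (count (fun p => representable p && cond p) (iota B (n - B)) =
       \sum_(x <- classes) count (in_class x) (iota B (n - B)))%N.
    have : all (fun p => maxn bound M < p)%N (iota B (n - B)).
      by apply/allP => p; rewrite mem_iota => /andP[].
    elim: (iota B _) => /= [|p s IH]; first by rewrite big1.
    case/andP=> Bp /IH ->; rewrite class_sum // big_split //.
  rewrite -big_split; apply: eq_bigr => x _.
  rewrite /HL_count -[in LHS](subnKC Bn) iotaD count_cat add0n //.
rewrite H -[in LHS](subnKC Bn) iotaD count_cat add0n !natrD.
by rewrite [RHS]addrC subrKA.
Qed.

Lemma count_representable_cvg :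
  (fun n => (count (fun p => representable p && cond p) (iota 0 n))%:R / HL_scale n)
    @ \oo --> ((size classes)%:R : R).
Proof.
have [k kE] := count_classes.
rewrite -[X in _ --> X]addr0.
apply: (@cvg_trans _ ((fun n => \sum_(x <- classes)
   ((HL_count a (b x) (c x) n)%:R / HL_scale n) + k / HL_scale n) @ \oo)).
  apply: near_eq_cvg; near=> n.
  rewrite kE; last by near: n; exact: nbhs_infty_gt.
  by rewrite natr_sum mulrDl mulr_suml.
apply: cvgD; last exact: HL_scale_inv_cvg0.
apply: (@cvg_sum_seq _ _ _ (fun x n => (HL_count a (b x) (c x) n)%:R / HL_scale n)).
by move=> x; rewrite mem_filter => /andP[/andP[ax _] _]; exact: HL_class.
Unshelve. all: by end_near. Qed.

End Density.

Section DensityOfResidues.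
Local Open Scope classical_set_scope.

(** The counts are, up to a constant, sums over residue classes of counts that all
    have the same asymptotics [HL_scale], which cancels in the quotient. *)
Lemma HL_density (R : realType) (m : int) (M : nat) (good cond : pred nat) (bound : nat) :
  HardyLittlewood R -> m != 0 -> (0 < M)%N -> ~~ odd M ->
  (forall p x : nat, prime p -> p%:Z = m ^+ 2 + x%:Z ^+ 2 -> (bound < p)%N ->
     cond p = good (x %% M)%N) ->
  has (admissible m M) (iota 0 M) ->
  (fun N => (count cond (Qseq m N))%:R / (size (Qseq m N))%:R) @ \oo -->
  ((count (fun x => admissible m M x && good x) (iota 0 M))%:R /
   (count (admissible m M) (iota 0 M))%:R : R).
Proof.
move=> HL m0 M0 M_even condP; rewrite has_count => adm0.
have C1 := count_representable_cvg HL m0 M0 M_even condP.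
have C2 := @count_representable_cvg R m M HL m0 M0 M_even predT predT 0
  (fun p x _ _ _ => erefl).
rewrite !size_filter in C1 C2.
rewrite (eq_count (a1 := fun x => _ && predT x) (a2 := admissible m M)) in C2; last first.
  by move=> x /=; rewrite andbT.
have adm1 : (count (admissible m M) (iota 0 M))%:R != 0 :> R.
  by rewrite pnatr_eq0 -lt0n.
have Y0 := cvgr_neq0 _ C2 adm1.
(* [Qseq m N] counts the primes p <= N, hence the shift by one. *)
pose w N : R := (count (fun p => representable m p && cond p) (iota 0 N))%:R
   / (count (fun p => representable m p && predT p) (iota 0 N))%:R.
have -> : (fun N => (count cond (Qseq m N))%:R / (size (Qseq m N))%:R)
          = [sequence w N.+1]_N.
  apply: funext => N; rewrite /w /Qseq size_filter count_filter.
  by congr (_%:R / _%:R); apply: eq_count => p /=; rewrite ?andbT // andbC.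
rewrite cvg_shiftS.
apply: cvg_trans (cvgM C1 (cvgV adm1 C2)); apply: near_eq_cvg; near=> N.
have : HL_scale R m M N != 0.
  have : (count (fun p => representable m p && predT p) (iota 0 N))%:R
         / HL_scale R m M N != 0 by near: N; exact: Y0.
  by apply: contra => /eqP ->; rewrite invr0 mulr0.
rewrite /w /=; move: (HL_scale R m M N) => G G0.
by rewrite invf_div mulrA divfK.
Unshelve. all: by end_near. Qed.

End DensityOfResidues.

Lemma tau_primes n : odd n ->
  (tau n)%:Z = \prod_(q <- primes n) ((quot_order q)%:Z - 1).
Proof.
move=> n_odd; rewrite /tau.
have : all (fun q => odd q && prime q) (primes n).
  apply/allP => q qn; rewrite (odd_primes n_odd qn) /=.
  by move: qn; rewrite mem_primes => /and3P[].
elim: (primes n) => [|q s IH] /=; first by rewrite !big_nil.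
case/andP=> /andP[q_odd q_pr] /IH {}IH; rewrite !big_cons PoszM IH; congr (_ * _).
have := prime_gt1 q_pr; rewrite /quot_order.
have := odd_mod q (erefl : odd 4 = false); rewrite q_odd.
by have := ltn_pmod q (isT : (0 < 4)%N); case: (q %% 4)%N => [|[|[|[|]]]] //= _ _; clear; lia.
Qed.

Lemma tau_gt0 n : odd n -> (0 < tau n)%N.
Proof.
move=> n_odd; rewrite /tau big_seq; apply: prodn_cond_gt0 => q qn.
have q_odd := odd_primes n_odd qn; move: qn; rewrite mem_primes => /and3P[q_pr _ _].
case: ifP => _; first exact: prime_gt0.
by rewrite subn_gt0 odd_prime_gt2.
Qed.

(** * The density of one trace *)

(** The odd prime factors of dbar with their exponents. *)
Definition weighted_primes (dp dq dl : nat) : seq (nat * nat) :=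
  [seq (q, 1%N) | q <- primes dp] ++ [seq (q, 2%N) | q <- primes dq]
  ++ [seq (q, 3%N) | q <- primes dl].

Section OneTrace.
Variables (m h : int) (D : int) (s : bool) (d dp dq dl : nat).
Hypothesis mh : m = h * 2.
Hypothesis m0 : m != 0.
Hypothesis DE : D = d%:Z * ((-1) ^+ s * (2 * dp * dq ^ 2 * dl ^ 3)%N%:Z).
Hypothesis d_gt0 : (0 < d)%N.
Hypothesis d_odd : odd d.
Hypothesis dm : forall q : nat, prime q -> (q %| d)%N -> (q%:Z %| m)%Z.
Hypothesis dpP : [/\ (0 < dp)%N, odd dp & squarefree dp].
Hypothesis dqP : [/\ (0 < dq)%N, odd dq & squarefree dq].
Hypothesis dlP : [/\ (0 < dl)%N, odd dl & squarefree dl].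
Hypotheses (Hpq : coprime dp dq) (Hpl : coprime dp dl) (Hql : coprime dq dl).
Hypothesis dbarm : forall q : nat, prime q ->
  (q %| dp)%N || (q %| dq)%N || (q %| dl)%N -> ~~ (q%:Z %| m)%Z.

Local Notation L := (weighted_primes dp dq dl).

Lemma map_fst_weighted : map fst L = primes dp ++ primes dq ++ primes dl.
Proof.
have E (k : nat) (t : seq nat) : map fst [seq (q, k) | q <- t] = t.
  by elim: t => //= q t ->.
by rewrite /weighted_primes !map_cat !E.
Qed.

Lemma weighted_uniq : uniq (map fst L).
Proof.
rewrite map_fst_weighted; have [dp0 _ _] := dpP; have [dq0 _ _] := dqP.
have [dl0 _ _] := dlP.
have H1 := perm_primes_mul dq0 dl0 Hql.
have dql0 : (0 < dq * dl)%N by rewrite muln_gt0 dq0.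
have H2 := perm_primes_mul dp0 dql0; rewrite coprimeMr Hpq Hpl in H2.
have := perm_trans (H2 isT) (_ : perm_eq _ (primes dp ++ primes dq ++ primes dl)).
rewrite perm_cat2l => /(_ H1) /perm_uniq <-; exact: primes_uniq.
Qed.

Lemma weighted_ok : all (weight_ok m) L.
Proof.
have [_ dp_odd _] := dpP; have [_ dq_odd _] := dqP; have [_ dl_odd _] := dlP.
have H n k : odd n -> (0 < k < 4)%N -> (forall q, (q %| n)%N ->
    (q %| dp)%N || (q %| dq)%N || (q %| dl)%N) -> all (weight_ok m) [seq (q, k) | q <- primes n].
  move=> n_odd k4 nd; apply/allP => _ /mapP[q qn ->].
  rewrite /weight_ok /= k4 (odd_primes n_odd qn) andbT /=.
  by move: qn; rewrite mem_primes => /and3P[q_pr _ /nd qn]; rewrite q_pr dbarm.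
by rewrite /weighted_primes !all_cat !H // => q ->; rewrite ?orbT.
Qed.

Lemma wmodulus_odd : odd (wmodulus L).
Proof.
rewrite /wmodulus; have := weighted_ok; elim: L => [|u l IH] /=; first by rewrite big_nil.
by case/andP=> /and4P[_ uo _ _] /IH; rewrite big_cons oddM uo.
Qed.

Lemma wmodulus_gt0 : (0 < wmodulus L)%N. Proof. exact/odd_gt0/wmodulus_odd. Qed.

Lemma wexponent_weighted e y : wexponent e L y =
  (\sum_(q <- primes dp) e q y + 2 * \sum_(q <- primes dq) e q y
   + 3 * \sum_(q <- primes dl) e q y)%N.
Proof.
rewrite /wexponent /weighted_primes !big_cat !big_map /= !big_distrr /= addnA.
by under eq_bigr do rewrite mul1n.
Qed.

Lemma m_even : (2 %| m)%Z. Proof. by rewrite mh dvdz_mull. Qed.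

Lemma odd_sum_squares (y : nat) : odd (absz (y%:Z ^+ 2 + m ^+ 2)) = odd y.
Proof.
rewrite -[odd _]negbK -dvdn2 -[(2 %| absz _)%N]/(2 %| y%:Z ^+ 2 + m ^+ 2)%Z.
rewrite rpredDr; last by rewrite expr2 dvdz_mull // m_even.
by rewrite expr2 -PoszM -[(2 %| _)%Z]/(2 %| y * y)%N dvdn2 oddM andbb negbK.
Qed.

(** The part at 2 of the modulus asks for x^2 + m^2 to be odd, that is, for x odd. *)
Lemma admissible_weighted y :
  admissible m (4 * wmodulus L) y = odd y && wunit m L y.
Proof.
rewrite /admissible coprimeMl; congr (_ && _).
  by rewrite -[4%N]/(2 ^ 2)%N coprime_pexpl // coprime2n odd_sum_squares.
rewrite /wmodulus /wunit; have := weighted_ok; elim: L => [|u l IH] /=.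
  by rewrite big_nil coprime1n.
case/andP=> /and4P[u_pr _ _ _] /IH {}IH.
by rewrite big_cons coprimeMl IH prime_coprime.
Qed.

Section Counts.
Variable e : nat -> nat -> nat.
Hypothesis eP : forall q, prime q -> odd q -> residue_exponent m q (e q).

(** The parity that decides the sign of B. *)
Definition sign_parity : nat :=
  (s + three_mod4 d + three_mod4 dp + three_mod4 dl + (4 %| (h + 1)%R)%Z)%N.

Definition good_residue (y : nat) : bool :=
  if (2 %| h)%Z then (4 %| (wexponent e L y)%:Z - (y%:Z + h))%Z
  else (wexponent e L y == 2 * sign_parity %[mod 4])%N.

Lemma wexponent_period4 y : wexponent e L (y %% (4 * wmodulus L)) = wexponent e L y.
Proof.
have [_ <-] := wunit_wexponent_period eP (y %% (4 * wmodulus L))%N weighted_ok.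
by rewrite modn_dvdm ?dvdn_mull //; have [_ ->] := wunit_wexponent_period eP y weighted_ok.
Qed.

Lemma eqmod4_dvdz (a b : nat) : (a == b %[mod 4])%N = (4 %| a%:Z - b%:Z)%Z.
Proof. by clear; apply/eqP/idP; lia. Qed.

Lemma ap_good_residue p x : prime p -> p%:Z = m ^+ 2 + x%:Z ^+ 2 ->
  (absz (2 * D)%R < p)%N ->
  (~~ (p%:Z %| 2 * D)%Z && (ap D p == 2 * m)) = good_residue (x %% (4 * wmodulus L))%N.
Proof.
move=> p_pr p_sum Dp.
have D0 : 2 * D != 0.
  have [dp0 _ _] := dpP; have [dq0 _ _] := dqP; have [dl0 _ _] := dlP.
  rewrite DE !mulf_neq0 //; first by rewrite -lt0n.
    by rewrite signr_eq0.
  by rewrite -lt0n !muln_gt0 ?expn_gt0 dp0 dq0 dl0.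
have pD2 : ~~ (p%:Z %| 2 * D)%Z.
  apply/negP => pD; have := dvdn_leq _ pD; rewrite absz_gt0 D0 => /(_ isT).
  by rewrite leqNgt Dp.
have pD : ~~ (p%:Z %| D)%Z by apply: contra pD2; exact: dvdz_mull.
have x_odd : odd x.
  rewrite -odd_sum_squares addrC -p_sum absz_nat.
  apply: contraT => p_even; have p2 : p = 2%N by apply: prime_oddPn.
  by move: pD2; rewrite p2 dvdz_mulr.
rewrite pD2 /= (ap_condition p_pr p_sum mh m0 x_odd eP DE pD d_odd dm dpP dqP dlP).
rewrite /good_residue wexponent_period4 wexponent_weighted; case: ifP => _.
  have : (x %% (4 * wmodulus L) = x %[mod 4])%N by rewrite modn_dvdm // dvdn_mulr.
  move: (_ + _ + _)%N (x %% (4 * wmodulus L))%N; clear => T r rx.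
  by apply/idP/idP; lia.
by rewrite eqmod4_dvdz PoszM.
Qed.

Lemma coprime4_wmodulus : coprime 4 (wmodulus L).
Proof. by rewrite -[4%N]/(2 ^ 2)%N coprime_pexpl // coprime2n wmodulus_odd. Qed.

Lemma wunit_period y : wunit m L (y %% wmodulus L) = wunit m L y.
Proof. by have [] := wunit_wexponent_period eP y weighted_ok. Qed.

Lemma count_admissible :
  (count (admissible m (4 * wmodulus L)) (iota 0 (4 * wmodulus L)))%:Z = 2 * fourier0 L.
Proof.
rewrite (eq_count admissible_weighted).
rewrite (count_crt (A := odd) coprime4_wmodulus) ?wmodulus_gt0 //.
- by rewrite PoszM (count_wunit eP weighted_ok weighted_uniq).
- by move=> y; rewrite odd_mod.
exact: wunit_period.
Qed.

Lemma count_residue_class (A : pred nat) (t : nat) : (forall y, A (y %% 4)%N = A y) ->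
  count (fun y => A y && (wunit m L y && (wexponent e L y == t %[mod 4])%N))
        (iota 0 (4 * wmodulus L)) = (count A (iota 0 4) * wcount m e L t)%N.
Proof.
move=> A4; rewrite (count_crt coprime4_wmodulus) ?wmodulus_gt0 // => y.
by have [-> ->] := wunit_wexponent_period eP y weighted_ok.
Qed.

(** For h odd the two odd classes of x modulo 4 ask for the same exponent. For h even
    they ask for the two odd exponents, which are equally frequent. *)
Lemma count_good_residue :
  4 * (count (fun y => admissible m (4 * wmodulus L) y && good_residue y)
             (iota 0 (4 * wmodulus L)))%:Z =
  if (2 %| h)%Z then 2 * (fourier0 L - fourier2 L)
  else 2 * (fourier0 L + fourier2 L + 2 * (-1) ^+ sign_parity * fourier1 L).
Proof.
have F := wcount_fourier eP _ weighted_ok weighted_uniq.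
rewrite /good_residue; case: ifP => h2; last first.
  rewrite (eq_count (a2 := fun y => odd y && (wunit m L y &&
     (wexponent e L y == 2 * sign_parity %[mod 4])%N))); last first.
    by move=> y; rewrite admissible_weighted andbA.
  rewrite count_residue_class => [|y]; last by rewrite odd_mod.
  rewrite PoszM mulrCA F exprM sqrrN !expr1n mul1r; congr (_ * (_ + _ * _)); congr (_ * _).
  rewrite -signr_odd -re4_mod mod4_double.
  by case: (odd _).
pose t (r : int) : nat := absz ((r + h) %% 4)%Z.
have tE r T y : (y %% 4 = r)%N -> (4 %| T%:Z - (y%:Z + h))%Z = (T == t r%:Z %[mod 4])%N.
  by rewrite /t => yr; rewrite eqmod4_dvdz; clear - yr; apply/idP/idP; lia.
have -> : count (fun y => admissible m (4 * wmodulus L) y && (4 %| (wexponent e L y)%:Z - (y%:Z + h))%Z)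
    (iota 0 (4 * wmodulus L)) =
  (count (fun y => (y %% 4 == 1)%N && (wunit m L y && (wexponent e L y == t 1 %[mod 4])%N))
    (iota 0 (4 * wmodulus L)) +
   count (fun y => (y %% 4 == 3)%N && (wunit m L y && (wexponent e L y == t 3 %[mod 4])%N))
    (iota 0 (4 * wmodulus L)))%N.
  rewrite -count_predUI [X in (_ + X)%N](eq_count (a2 := pred0)) ?count_pred0 ?addn0; last first.
    by move=> y /=; case: eqP => [->|] //=; rewrite andbF.
  apply: eq_count => y /=; rewrite admissible_weighted.
  have := odd_mod y (erefl : odd 4 = false); have := tE _ (wexponent e L y) y erefl.
  have := ltn_pmod y (isT : (0 < 4)%N).
  by case: (y %% 4)%N => [|[|[|[|]]]] //= _ -> <-; rewrite ?orbF.
rewrite !count_residue_class; try by move=> y; rewrite modn_mod.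
rewrite !mul1n PoszD mulrDr !F.
have t_odd r : (r == 1) || (r == 3) -> odd (t r).
  by rewrite /t => r13; clear - h2 r13; lia.
have R k : odd k -> re4 k = 0.
  rewrite -re4_mod -(odd_mod k (erefl : odd 4 = false)).
  by have := ltn_pmod k (isT : (0 < 4)%N); case: (k %% 4)%N => [|[|[|[|]]]].
by rewrite !R ?t_odd // -[(-1) ^+ t 1]signr_odd -[(-1) ^+ t 3]signr_odd !t_odd //; ring.
Qed.

End Counts.

Lemma fourier0_weighted : fourier0 L = (tau dp * tau dq * tau dl)%N%:Z.
Proof.
have [_ dp_odd _] := dpP; have [_ dq_odd _] := dqP; have [_ dl_odd _] := dlP.
rewrite /fourier0 /weighted_primes !PoszM !tau_primes //.
move: (primes dp) (primes dq) (primes dl) => a b c.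
by rewrite !big_cat !big_map /= mulrA.
Qed.

Lemma fourier1_weighted : fourier1 L = (-1) ^+ (nprimes dp + nprimes dq + nprimes dl).
Proof.
rewrite /fourier1 /weighted_primes /nprimes.
move: (primes dp) (primes dq) (primes dl) => a b c.
by rewrite !size_cat !size_map addnA.
Qed.

Lemma fourier2_weighted : fourier2 L = (-1) ^+ (nprimes dp + nprimes dl) * (tau dq)%:Z.
Proof.
have [_ dq_odd _] := dqP.
have E t : \prod_(q <- t) (-1 : int) = (-1) ^+ size t.
  by elim: t => [|q t IH]; rewrite ?big_nil // big_cons IH exprS.
rewrite /fourier2 /weighted_primes /nprimes tau_primes // exprD.
move: (primes dp) (primes dq) (primes dl) => a b c.
by rewrite !big_cat !big_map /= !E; ring.
Qed.

Lemma one_trace_density (R : realType) : HardyLittlewood R ->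
  let S0 : R := (tau dp * tau dq * tau dl)%:R in
  let S1 : R := (-1) ^+ (nprimes dp + nprimes dq + nprimes dl) in
  let S2 : R := (-1) ^+ (nprimes dp + nprimes dl) * (tau dq)%:R in
  has_dens D m (if (2 %| h)%Z then (S0 - S2) / (4 * S0)
                else (S0 + S2 + 2 * (-1) ^+ sign_parity * S1) / (4 * S0)).
Proof.
move=> HL S0 S1 S2; have [e eP] := exists_residue_exponents m.
have [_ dp_odd _] := dpP; have [_ dq_odd _] := dqP; have [_ dl_odd _] := dlP.
have tau0 : (0 < tau dp * tau dq * tau dl)%N by rewrite !muln_gt0 !tau_gt0.
have C1 := count_admissible eP; have C2 := count_good_residue eP.
rewrite fourier0_weighted in C1; rewrite fourier0_weighted fourier1_weighted fourier2_weighted in C2.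
have W0 : (0 < 4 * wmodulus L)%N by rewrite muln_gt0 wmodulus_gt0.
have adm : has (admissible m (4 * wmodulus L)) (iota 0 (4 * wmodulus L)).
  rewrite has_count -ltz_nat C1; move: tau0; clear; lia.
have := @HL_density R m (4 * wmodulus L) (good_residue e)
  (fun p => ~~ (p%:Z %| 2 * D)%Z && (ap D p == 2 * m)) (absz (2 * D))
  HL m0 W0 _ (fun p x p_pr p_sum Dp => ap_good_residue eP p_pr p_sum Dp) adm.
rewrite oddM => /(_ isT); rewrite /has_dens /dens_quotient.
set good := count _ _ in C2 *; set total := count _ _ in C1 *.
suff -> : good%:R / total%:R = (if (2 %| h)%Z then (S0 - S2) / (4 * S0)
                else (S0 + S2 + 2 * (-1) ^+ sign_parity * S1) / (4 * S0)) by [].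
have S0_neq0 : S0 != 0 by rewrite pnatr_eq0 -lt0n.
have {}C1 : total%:R = 2 * S0.
  by have := congr1 (fun z : int => z%:~R : R) C1; rewrite rmorphM /= -!pmulrn.
have {}C2 : 4 * good%:R = if (2 %| h)%Z then 2 * (S0 - S2)
       else 2 * (S0 + S2 + 2 * (-1) ^+ sign_parity * S1).
  have := congr1 (fun z : int => z%:~R : R) C2; rewrite rmorphM /= -!pmulrn => ->.
  by case: ifP => _; rewrite /S0 /S1 /S2 !(rmorphM, rmorphD, rmorphB, rmorphN) /= !rmorph_sign -!pmulrn.
have -> : good%:R = (4 * good%:R) / 4 :> R by field.
by rewrite C2 C1; clearbody S0 S1 S2; case: ifP => _; field; rewrite S0_neq0.
Qed.

End OneTrace.

Section Values.
Variables (R : realType) (dp dq dl d : nat).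
Hypothesis d_odd : odd d.
Hypothesis dpP : [/\ (0 < dp)%N, odd dp & squarefree dp].
Hypothesis dqP : [/\ (0 < dq)%N, odd dq & squarefree dq].
Hypothesis dlP : [/\ (0 < dl)%N, odd dl & squarefree dl].
Hypotheses (Hpq : coprime dp dq) (Hpl : coprime dp dl) (Hql : coprime dq dl).

Let S0 : R := (tau dp * tau dq * tau dl)%:R.
Let S1 : R := (-1) ^+ (nprimes dp + nprimes dq + nprimes dl).
Let S2 : R := (-1) ^+ (nprimes dp + nprimes dl) * (tau dq)%:R.
Let A : R := (-1) ^+ (nprimes dp + nprimes dl) / (tau (dp * dl))%:R.
Let B : R := 2 * (-1) ^+ (nprimes_mod8 1 dp + nprimes_mod8 5 dp
                 + nprimes_mod8 1 dl + nprimes_mod8 5 dl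
                 + nprimes dq + (d - 1) %/ 2) / (tau (dp * dq * dl))%:R.

(** The local sums of the squared character are -1 at the prime factors of dp and
    dl and trivial at those of dq, whose contribution tau(dq) cancels. *)
Lemma value_A : S2 / S0 = A.
Proof.
have [dp0 dp_odd _] := dpP; have [dq0 dq_odd _] := dqP; have [dl0 dl_odd _] := dlP.
have H n : odd n -> (tau n)%:R != 0 :> R by move=> n_odd; rewrite pnatr_eq0 -lt0n tau_gt0.
rewrite /A tauM // /S2 /S0 !natrM; move: (H _ dp_odd) (H _ dq_odd) (H _ dl_odd).
move: ((tau dp)%:R : R) ((tau dq)%:R : R) ((tau dl)%:R : R) => x y z x0 y0 z0.
by field; rewrite x0 y0 z0.
Qed.

(** The signs: -1 for each prime factor of dp dq dl from its local sum, and, from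
    chi(-1) = -1, a further -1 for each prime factor of d dp dl that is 3 modulo 4,
    counted with multiplicity. *)
Lemma value_B : 2 * (-1) ^+ (three_mod4 d + three_mod4 dp + three_mod4 dl) * S1 / S0 = B.
Proof.
have [dp0 dp_odd dp_sf] := dpP; have [dq0 dq_odd dq_sf] := dqP.
have [dl0 dl_odd dl_sf] := dlP.
rewrite /B !tauM ?muln_gt0 ?dp0 // ?coprimeMl ?Hpl //; congr (_ / _).
rewrite -mulrA -exprD; congr (_ * _); rewrite -signr_odd -[RHS]signr_odd; congr (_ ^+ nat_of_bool _).
have Ep := nprimes_mod8_parity dp0 dp_odd dp_sf.
have El := nprimes_mod8_parity dl0 dl_odd dl_sf.
have Ed := half_pred_parity d_odd.
rewrite !oddD !oddb; rewrite !oddD !oddb in Ep El; rewrite Ed.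
move: Ep El; case: (odd (nprimes_mod8 1 dp)); case: (odd (nprimes_mod8 5 dp));
case: (odd (nprimes_mod8 1 dl)); case: (odd (nprimes_mod8 5 dl));
case: (odd (nprimes dp)); case: (odd (nprimes dl)); case: (odd (nprimes dq));
case: (three_mod4 dp); case: (three_mod4 dl); by case: (three_mod4 d).
Qed.

Lemma S0_neq0 : S0 != 0.
Proof.
have [_ dp_odd _] := dpP; have [_ dq_odd _] := dqP; have [_ dl_odd _] := dlP.
by rewrite pnatr_eq0 -lt0n !muln_gt0 !tau_gt0.
Qed.

Lemma value_even : (S0 - S2) / (4 * S0) = 1 / 4 * (1 - A).
Proof. by rewrite -value_A; have := S0_neq0; move: S0 S2 => x y x0; field. Qed.

Lemma value_odd (eps : nat) :
  (S0 + S2 + 2 * (-1) ^+ (eps + (three_mod4 d + three_mod4 dp + three_mod4 dl)) * S1) / (4 * S0)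
  = 1 / 4 * (1 + A + (-1) ^+ eps * B).
Proof.
rewrite -value_A -value_B exprD; have := S0_neq0.
move: ((-1) ^+ eps) ((-1) ^+ (_ + _ + _)) S0 S1 S2 => e1 e2 x y z x0.
by field.
Qed.

End Values.

Unset Implicit Arguments.

Theorem theorem4p10 (R : realType)
  (HL : HardyLittlewood R)
  (* D = +-2 p_1 ... p_r (q_1 ... q_s)^2 (l_1 ... l_t)^3 *)
  (D : int) (sD : bool) (ps qs ls : seq nat)
  (Hodd : all (fun p => prime p && odd p) (ps ++ qs ++ ls))
  (Huniq : uniq (ps ++ qs ++ ls))
  (HD : D = (-1) ^+ sD *
     (2 * \prod_(p <- ps) p * (\prod_(q <- qs) q) ^ 2
        * (\prod_(l <- ls) l) ^ 3)%N%:Z)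
  (beta : int) (Hbeta0 : beta != 0) (Hbeta2 : (2 %| beta)%Z)
  (* D = d * dbar *)
  (d : nat) (dbar : int)
  (Hd : D = d%:Z * dbar) (Hcop : coprimez d%:Z dbar)
  (Hdpos : (0 < d)%N) (Hdodd : odd d)
  (Hdbeta : forall p : nat, prime p -> (p %| d)%N -> (p%:Z %| beta)%Z)
  (Hdbarbeta : forall p : nat, prime p -> odd p -> (p%:Z %| dbar)%Z ->
     ~~ (p%:Z %| beta)%Z)
  (* dbar = +-2 dp dq^2 dl^3 *)
  (sdbar : bool) (dp dq dl : nat)
  (Hdbar : dbar = (-1) ^+ sdbar * (2 * dp * dq ^ 2 * dl ^ 3)%N%:Z)
  (Hdp : [/\ (0 < dp)%N, odd dp & squarefree dp])
  (Hdq : [/\ (0 < dq)%N, odd dq & squarefree dq])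
  (Hdl : [/\ (0 < dl)%N, odd dl & squarefree dl])
  (Hpq : coprime dp dq) (Hpl : coprime dp dl) (Hql : coprime dq dl)
  (Hdbar_odd : exists p : nat, [/\ prime p, odd p & (p%:Z %| dbar)%Z]) :
  let A : R := (-1) ^+ (nprimes dp + nprimes dl) / (tau (dp * dl))%:R in
  let B : R :=
    2 * (-1) ^+ (nprimes_mod8 1 dp + nprimes_mod8 5 dp
                 + nprimes_mod8 1 dl + nprimes_mod8 5 dl
                 + nprimes dq + (d - 1) %/ 2)
      / (tau (dp * dq * dl))%:R in
  (exact_pow2 1 beta -> (beta = 2 %[mod 8])%Z ->
     (0 < D -> has_dens D beta (1 / 4 * (1 + A + B)) /\
               has_dens D (- beta) (1 / 4 * (1 + A - B))) /\
     (D < 0 -> has_dens D beta (1 / 4 * (1 + A - B)) /\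
               has_dens D (- beta) (1 / 4 * (1 + A + B)))) /\
  ((4 %| beta)%Z ->
     has_dens D beta (1 / 4 * (1 - A)) /\
     has_dens D (- beta) (1 / 4 * (1 - A))).
Proof.
move=> A B.
have DE : D = d%:Z * ((-1) ^+ sdbar * (2 * dp * dq ^ 2 * dl ^ 3)%N%:Z) by rewrite Hd Hdbar.
have [dp0 dp_odd dp_sf] := Hdp; have [dq0 dq_odd dq_sf] := Hdq.
have [dl0 dl_odd dl_sf] := Hdl.
have prime_to q : prime q -> (q %| dp)%N || (q %| dq)%N || (q %| dl)%N ->
    ~~ (q%:Z %| beta)%Z.
  move=> q_pr qd; apply: Hdbarbeta => //.
    case/orP: qd => [/orP[]|] qd; [exact: dvdn_odd qd dp_odd | exact: dvdn_odd qd dq_odd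
      | exact: dvdn_odd qd dl_odd].
  rewrite Hdbar dvdz_mull // -[(_ %| _)%Z]/(q %| 2 * dp * dq ^ 2 * dl ^ 3)%N.
  case/orP: qd => [/orP[]|] qd.
  - by rewrite -!mulnA dvdn_mull // dvdn_mulr.
  - by rewrite dvdn_mulr // dvdn_mull // expnS dvdn_mulr.
  by rewrite dvdn_mull // expnS dvdn_mulr.
have [h bh] := dvdzP Hbeta2.
have dens (m k : int) : m = k * 2 -> m != 0 ->
    (forall q : nat, (q%:Z %| m)%Z = (q%:Z %| beta)%Z) ->
    has_dens D m (if (2 %| k)%Z then 1 / 4 * (1 - A)
                  else 1 / 4 * (1 + A + (-1) ^+ (sdbar + (4 %| (k + 1)%R)%Z)%N * B)).
  move=> mk m0 mb.
  have dm q : prime q -> (q %| d)%N -> (q%:Z %| m)%Z by rewrite mb; exact: Hdbeta.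
  have dbarm q : prime q -> (q %| dp)%N || (q %| dq)%N || (q %| dl)%N ->
      ~~ (q%:Z %| m)%Z by rewrite mb; exact: prime_to.
  have := one_trace_density mk m0 DE Hdpos Hdodd dm Hdp Hdq Hdl Hpq Hpl Hql dbarm HL.
  rewrite /A /B -(value_even R Hdp Hdq Hdl Hpl).
  rewrite -(value_odd R Hdodd Hdp Hdq Hdl Hpq Hpl Hql) /sign_parity.
  have -> : (sdbar + three_mod4 d + three_mod4 dp + three_mod4 dl + (4 %| (k + 1)%R)%Z =
    sdbar + (4 %| (k + 1)%R)%Z + (three_mod4 d + three_mod4 dp + three_mod4 dl))%N.
    by clear; lia.
  exact.
have Db := dens beta h bh Hbeta0 (fun=> erefl).
have nbh : - beta = - h * 2 by rewrite bh mulNr.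
have Dnb := dens (- beta) (- h) nbh _ (fun q => _).
rewrite oppr_eq0 in Dnb; have {}Dnb := Dnb Hbeta0 (fun q => rpredN _ _).
have N0 : 0 < d%:Z * (2 * dp * dq ^ 2 * dl ^ 3)%N%:Z.
  by rewrite -PoszM ltz_nat !muln_gt0 ?expn_gt0 Hdpos dp0 dq0 dl0.
have sgnD : D = (-1) ^+ sdbar * (d%:Z * (2 * dp * dq ^ 2 * dl ^ 3)%N%:Z).
  by rewrite DE mulrCA.
split=> [_ b8|b4].
  have h2 : (2 %| h)%Z = false by clear - bh b8; lia.
  have nh2 : (2 %| - h)%Z = false by clear - bh b8; lia.
  have h4 : (4 %| h + 1)%Z = false by clear - bh b8; lia.
  have nh4 : (4 %| - h + 1)%Z by clear - bh b8; lia.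
  rewrite h2 h4 in Db; rewrite nh2 nh4 in Dnb.
  split=> Ds; case: sdbar sgnD Db Dnb {Hdbar DE dens} => sgnD;
    rewrite /= ?expr0 ?expr1 ?mul1r ?mulN1r //.
  - by move: Ds; rewrite sgnD expr1 mulN1r oppr_gt0 ltNge ltW.
  - by rewrite sqrrN expr1n mul1r.
  by move: Ds; rewrite sgnD expr0 mul1r ltNge ltW.
have h2 : (2 %| h)%Z by clear - bh b4; lia.
have nh2 : (2 %| - h)%Z by clear - bh b4; lia.
by rewrite h2 in Db; rewrite nh2 in Dnb.
Qed.
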